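(* Let $\lambda=e^{2\pi i\omega}$ with $\omega\in\mathbb R\setminus\mathbb Q$, and let $F(z,\bar z)=\lambda z\bigl(1+f(|z|^2)\bigr)e^{2\pi i g(z,\bar z)}$ be a local analytic diffeomorphism from $(\mathbb R^2,0)$ to $(\mathbb R^2,0)$, where $f(u)=\sum_{n\ge1}f_nu^n$ ($f_n\in\mathbb R$) and $g(z,\bar z)=\sum_{j+k\ge1}g_{jk}z^j\bar z^k$ ($g_{kj}=\overline{g_{jk}}$) are real analytic germs. Suppose that the holomorphic germ in one complex variable $F^0(z)=\lambda z e^{2\pi i g(z,0)}$ is analytically non linearizable. Then any formal conjugacy $\Psi$ of $F$ to a normal form $N$ is divergent.
   Context: $\mathbb R^2$ is identified with $\mathbb C$, and (formal or analytic) maps are written as power series in $z,\bar z$. Here $g(z,0)=\sum_{j\ge1}g_{j0}z^j$. A normal form is a formal map $N(z)=\lambda z\bigl(1+\sum_{k\ge1}\alpha_k|z|^{2k}\bigr)$ with $\alpha_k\in\mathbb C$. A formal conjugacy of $F$ to $N$ is a formal diffeomorphism $\Psi(z)=z+\sum_{p+q\ge2}\psi_{pq}z^p\bar z^q$, $\psi_{pq}\in\mathbb C$, such that $\Psi\circ F=N\circ\Psi$. It is divergent if its power series in $(z,\bar z)$ (viewed as two independent variables) converges in no neighborhood of $0$. A holomorphic germ $F^0(z)=\lambda z+O(z^2)$ is analytically linearizable if there is a holomorphic germ $h(z)=z+O(z^2)$ with $h\circ F^0=\lambda h$. *)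

(* Defs.v *)
From HB Require Import structures.
From mathcomp Require Import all_boot all_order all_algebra.
From mathcomp Require Import complex.
From mathcomp Require Import all_classical all_reals all_analysis.

Set Implicit Arguments.
Unset Strict Implicit.
Unset Printing Implicit Defensive.

Import Order.TTheory GRing.Theory Num.Theory.
Import numFieldNormedType.Exports.

Local Open Scope classical_set_scope.
Local Open Scope ring_scope.
Local Open Scope complex_scope.

(* The norm topology of C = R[i], as a normed module over itself. *)
HB.instance Definition _ (R : realType) :=
  PseudoPointedMetric.copy R[i] R[i]^o.
HB.instance Definition _ (R : realType) := NormedModule.copy R[i] R[i]^o.

Definition cexp (R : realType) (z : R[i]) : R[i] :=
  (expR (complex.Re z) * cos (complex.Im z))
  +i* (expR (complex.Re z) * sin (complex.Im z)).

(* [e2pii z] is e^{2 pi i z}. *)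
Definition e2pii (R : realType) (z : R[i]) : R[i] :=
  cexp ((0 +i* (2 * pi)) * z).

(* A formal power series in two independent variables (z, w), given by its
   coefficients: [a p q] is the coefficient of z^p w^q. A formal map of R^2 = C
   is such a series, with w standing for the conjugate of z. *)
Definition fps2 (R : realType) := nat -> nat -> R[i].

Section Convergence.
Variable R : realType.
Local Notation C := (R[i]).
Implicit Types (a : fps2 R) (F G h : C -> C) (z w lam : C).

Definition term2 a z w (k : nat * nat) : C :=
  a k.1 k.2 * z ^+ k.1 * w ^+ k.2.

(* Convergence of a series in several variables is absolute convergence. *)
Definition convergent2 a : Prop :=
  \forall z \near (0 : C) & w \near (0 : C),
    summable [set: nat * nat] (fun k => (complex.Re `|term2 a z w k|)%:E).

Definition psum2 a z w : C :=
  lim ((fun n : nat => \sum_(p < n) \sum_(q < n) term2 a z w (val p, val q))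
         @ \oo).

Definition convergent1 (f : nat -> R) : Prop :=
  \forall u \near (0 : R), cvgn (pseries f u).

Definition psum1 (f : nat -> R) (u : R) : R := limn (pseries f u).

Definition has_expansion F a : Prop :=
  convergent2 a /\ \forall z \near (0 : C), F z = psum2 a z (z^*).

Definition analytic_at0 F : Prop := exists a, has_expansion F a.

Definition local_analytic_diffeo F : Prop :=
  [/\ analytic_at0 F, F 0 = 0 &
   exists G, [/\ analytic_at0 G, G 0 = 0,
     \forall z \near (0 : C), G (F z) = z &
     \forall z \near (0 : C), F (G z) = z]].

(* [derivable] and [derive1] are taken over the field C: complex derivatives. *)
Definition analytically_linearizable lam F : Prop :=
  exists h, [/\ \forall z \near (0 : C), derivable h z 1,
    h 0 = 0, derive1 h 0 = 1 &
    \forall z \near (0 : C), h (F z) = lam * h z].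

End Convergence.

Section FormalMaps.
Variable R : realType.
Implicit Types a b F N Psi : fps2 R.

Definition fps2_one : fps2 R := fun m n => ((m == 0%N) && (n == 0%N))%:R.

Definition fps2_mul a b : fps2 R := fun m n =>
  \sum_(i < m.+1) \sum_(j < n.+1) a i j * b (m - i)%N (n - j)%N.

Definition fps2_exp a (k : nat) : fps2 R := iter k (fps2_mul a) fps2_one.

(* Conjugate of a(z, zbar), again as a series in (z, zbar). *)
Definition fps2_conj a : fps2 R := fun m n => (a n m)^*.

(* [fps2_subst a b c] is a(b, c); meaningful for b and c without constant term,
   so that b^p c^q contributes nothing in total degree < p + q. *)
Definition fps2_subst a b c : fps2 R := fun m n =>
  \sum_(p < (m + n).+1) \sum_(q < (m + n).+1)
     a p q * fps2_mul (fps2_exp b p) (fps2_exp c q) m n.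

Definition fmap_comp a b : fps2 R := fps2_subst a b (fps2_conj b).

(* lam z (1 + sum_(k >= 1) alpha_k |z|^(2k)), where z |z|^(2k) = z^(k+1) zbar^k;
   [alpha 0] is not used. *)
Definition normal_form (lam : R[i]) (alpha : nat -> R[i]) : fps2 R :=
  fun p q => if p == q.+1 then lam * (if q == 0%N then 1 else alpha q) else 0.

Definition formal_conjugacy F N Psi : Prop :=
  [/\ Psi 0%N 0%N = 0, Psi 1%N 0%N = 1, Psi 0%N 1%N = 0 &
   fmap_comp Psi F =2 fmap_comp N Psi].

End FormalMaps.

(* Main.v *)
(** Complexify: treat [z] and [w = conj z] as independent variables. The first
    component of the complexified map is divisible by [z], hence the second one,
    its conjugate, by [w]; so the line [w = 0] is invariant and the map restricts
    there to [F^0]. Let [phi] and [chi] be the restrictions to this line of [Psi]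
    and of its conjugate series. The conjugacy equation reads
      [phi o F^0 = lam * phi * (1 + O(phi chi))],
      [chi o F^0 = conj lam * chi * (1 + O(phi chi))].
    If [chi] were nonzero, of order [m >= 2], comparing leading coefficients
    would give [lam ^ (m + 1) = 1]; hence [chi = 0], and [phi] is a formal
    linearization of [F^0]. If [Psi] converges, so does [phi].

    The Taylor coefficients of [F] on [w = 0] are only accessible through its
    values on the totally real plane [w = conj z]: each homogeneous part of the
    expansion is a polynomial in [(z, w)], hence determined by that plane. *)
Require Import Defs.
From HB Require Import structures.
From mathcomp Require Import all_boot all_order all_algebra.
From mathcomp Require Import complex.
From mathcomp Require Import all_classical all_reals all_analysis.
From mathcomp Require Import ring lra zify.
Import Order.TTheory GRing.Theory Num.Theory.
Import numFieldNormedType.Exports.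
Local Open Scope classical_set_scope.
Local Open Scope ring_scope.
Local Open Scope complex_scope.

(** * The modulus of a complex number as a real number *)

Section ComplexModulus.
Context {R : realType}.
Implicit Types (x y z : R[i]).

(** The norm on [R[i]] takes values in [R[i]]; its real part is taken so that all estimates live in
    the totally ordered field [R]. *)
Definition cabs z : R := complex.Re `|z|.

Lemma cabsE z : `|z| = (cabs z)%:C.
Proof. by rewrite /cabs normc_def. Qed.

Lemma cabs_ge0 z : 0 <= cabs z.
Proof. by rewrite -lecR -cabsE normr_ge0. Qed.

Lemma cabs_eq0 z : cabs z = 0 -> z = 0.
Proof. by move=> z0; apply/normr0_eq0; rewrite cabsE z0. Qed.

Lemma cabsM x y : cabs (x * y) = cabs x * cabs y.
Proof. by apply: (@complexI R); rewrite rmorphM -!cabsE normrM. Qed.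

Lemma cabsD x y : cabs (x + y) <= cabs x + cabs y.
Proof. by rewrite -lecR rmorphD -!cabsE ler_normD. Qed.

Lemma cabsN x : cabs (- x) = cabs x.
Proof. by rewrite /cabs normrN. Qed.

Lemma cabsBC x y : cabs (x - y) = cabs (y - x).
Proof. by rewrite /cabs distrC. Qed.

Lemma cabs0 : cabs 0 = 0.
Proof. by rewrite /cabs normr0. Qed.

Lemma cabs1 : cabs 1 = 1.
Proof. by rewrite /cabs normr1. Qed.

Lemma cabsX x n : cabs (x ^+ n) = cabs x ^+ n.
Proof. by elim: n => [|n IH]; rewrite ?expr0 ?cabs1// !exprS cabsM IH. Qed.

Lemma cabsR (r : R) : cabs r%:C = `|r|.
Proof. by rewrite /cabs normc_def/= expr0n addr0 sqrtr_sqr. Qed.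

Lemma cabsJ x : cabs x^* = cabs x.
Proof. by rewrite /cabs normcJ. Qed.

Lemma cabs_sum (I : Type) (r : seq I) (P : pred I) (c : I -> R[i]) :
  cabs (\sum_(i <- r | P i) c i) <= \sum_(i <- r | P i) cabs (c i).
Proof.
apply: (big_ind2 (fun u v => cabs u <= v)); rewrite ?cabs0// => u1 v1 u2 v2 h1 h2.
by apply: le_trans (cabsD _ _) _; apply: lerD.
Qed.

Lemma cabs_sub_lipschitz x y : cabs x - cabs y <= cabs (x - y).
Proof. by rewrite lerBlDr; apply: le_trans (cabsD _ _); rewrite subrK. Qed.

Lemma Re_le_cabs z : `|complex.Re z| <= cabs z.
Proof. by rewrite -lecR -cabsE normc_ge_Re. Qed.

Lemma cabs_le_ReIm z : cabs z <= `|complex.Re z| + `|complex.Im z|.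
Proof.
rewrite {1}(complexE z); apply: le_trans (cabsD _ _) _.
by rewrite cabsM !cabsR lerD2l /cabs normc_def/= expr0n add0r expr1n sqrtr1 mul1r.
Qed.

Lemma Im_le_cabs z : `|complex.Im z| <= cabs z.
Proof.
suff -> : cabs z = cabs ('i * z).
  have -> : complex.Im z = - complex.Re ('i * z) by rewrite mulrC ReiNIm opprK.
  by rewrite normrN Re_le_cabs.
by rewrite cabsM /cabs [`|'i|]normc_def/= expr0n add0r expr1n sqrtr1 mul1r.
Qed.

End ComplexModulus.

(** * Series of complex numbers *)

Section Series.
Context {R : realType}.
Local Notation C := R[i].
Implicit Types (a b c : nat -> C) (l k : C) (M : R).

Lemma squeeze0 (u v : nat -> R) : (forall n, 0 <= u n) ->
  (forall n, u n <= v n) -> v @ \oo --> 0 -> u @ \oo --> 0.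
Proof.
move=> u0 uv v0; apply: (@squeeze_cvgr _ _ _ _ (cst 0) v) => //.
- by near=> n; rewrite u0 uv.
- exact: cvg_cst.
Unshelve. all: by end_near. Qed.

Lemma cvg_dist_lim (u : nat -> R) (s : R) : u @ \oo --> s ->
  (fun n => `|u n - s|) @ \oo --> (0 : R).
Proof.
by move=> us; rewrite -(@normr0 _ R) -(subrr s); apply: cvg_norm; apply: cvgB => //; apply: cvg_cst.
Qed.

(* Phrased with a real sequence, so that the library's real limits apply. *)
Definition converges (c : nat -> C) (l : C) : Prop :=
  (fun n => cabs (\sum_(i < n) c i - l)) @ \oo --> (0 : R).

Definition abs_bound (c : nat -> C) (M : R) : Prop :=
  forall n, \sum_(i < n) cabs (c i) <= M.

Lemma converges_ext a b l : a =1 b -> converges a l -> converges b l.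
Proof. by move=> /funext ->. Qed.

Lemma abs_bound_ext a b M : a =1 b -> abs_bound a M -> abs_bound b M.
Proof. by move=> /funext ->. Qed.

Lemma abs_bound_ge0 c M : abs_bound c M -> 0 <= M.
Proof. by move=> /(_ 0%N); rewrite big_ord0. Qed.

Lemma abs_bound_le a b M : (forall n, cabs (a n) <= cabs (b n)) ->
  abs_bound b M -> abs_bound a M.
Proof. by move=> ab bM n; apply: le_trans (bM n); apply: ler_sum. Qed.

Lemma abs_boundZ k c M : abs_bound c M -> abs_bound (fun n => k * c n) (cabs k * M).
Proof.
move=> cM n; under eq_bigr do rewrite cabsM.
by rewrite -mulr_sumr ler_wpM2l ?cabs_ge0.
Qed.

Lemma converges_unique c l k : converges c l -> converges c k -> l = k.
Proof.
move=> cl ck; apply/eqP; rewrite -subr_eq0; apply/eqP/cabs_eq0.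
have h : (fun=> cabs (l - k)) @ \oo --> (0 : R).
  apply: (@squeeze0 _ (fun n => cabs (\sum_(i < n) c i - l) + cabs (\sum_(i < n) c i - k))).
  - by move=> n; apply: cabs_ge0.
  - move=> n; rewrite (cabsBC _ l); apply: le_trans (cabsD _ _).
    by rewrite addrA subrK.
  - by rewrite -[0 in X in _ --> X](addr0 (0:R)); apply: cvgD.
exact: (cvg_unique _ (cvg_cst _) h).
Qed.

Lemma convergesZ k c l : converges c l -> converges (fun n => k * c n) (k * l).
Proof.
move=> cl; apply: (@squeeze0 _ (fun n => cabs k * cabs (\sum_(i < n) c i - l))).
- by move=> n; apply: cabs_ge0.
- by move=> n; rewrite -mulr_sumr -mulrBr cabsM.
- by rewrite -[0 in X in _ --> X](mulr0 (cabs k)); apply: cvgMr.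
Qed.

Lemma convergesD a b l k : converges a l -> converges b k ->
  converges (fun n => a n + b n) (l + k).
Proof.
move=> al bk.
apply: (@squeeze0 _ (fun n => cabs (\sum_(i < n) a i - l) + cabs (\sum_(i < n) b i - k))).
- by move=> n; apply: cabs_ge0.
- move=> n; rewrite big_split/= opprD addrACA; exact: cabsD.
- by rewrite -[0 in X in _ --> X](addr0 (0:R)); apply: cvgD.
Qed.

Lemma convergesB a b l k : converges a l -> converges b k ->
  converges (fun n => a n - b n) (l - k).
Proof.
move=> al bk; have := convergesD _ _ _ _ al (convergesZ (-1) _ _ bk).
by rewrite mulN1r; apply: converges_ext => n; rewrite mulN1r.
Qed.

Lemma converges_finite c N : (forall n, (N <= n)%N -> c n = 0) ->
  converges c (\sum_(i < N) c i).
Proof.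
move=> c0; rewrite /converges; apply: cvg_near_cst; near=> n.
have Nn : (N <= n)%N by near: n; exists N.
rewrite -(subnKC Nn) big_split_ord/= [X in _ + X - _]big1 ?addr0 ?subrr ?cabs0// => i _.
by rewrite c0// leq_addr.
Unshelve. all: by end_near. Qed.

Lemma converges_tail c l : converges c l <-> converges (fun n => c n.+1) (l - c 0%N).
Proof.
rewrite /converges -(cvg_shiftS (fun n => cabs (\sum_(i < n) c i - l))).
suff -> : (fun n => cabs (\sum_(i < n.+1) c i - l)) =
  (fun n => cabs (\sum_(i < n) c i.+1 - (l - c 0%N))) by [].
by apply/funext => n; rewrite big_ord_recl/=; congr cabs; rewrite opprD opprK addrC addrA addrC addrA.
Qed.

Lemma partial_sum_le c l M : converges c l -> abs_bound c M -> cabs l <= M.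
Proof.
move=> cl cM.
have h : (fun n => cabs (\sum_(i < n) c i - l) + M) @ \oo --> (0 + M).
  by apply: cvgD => //; apply: cvg_cst.
rewrite -[M in X in _ <= X]add0r; apply: (cvgr_to_ge h); near=> n.
rewrite cabsBC -lerBlDr; apply: le_trans (cabs_sub_lipschitz _ _).
by rewrite lerD2l lerN2; apply: le_trans (cabs_sum _ _ _ _) (cM n).
Unshelve. all: by end_near. Qed.

Lemma real_series_cvg (u : nat -> R) M :
  (forall n, 0 <= u n) -> (forall n, \sum_(i < n) u i <= M) ->
  exists s : R, (fun n => \sum_(i < n) u i) @ \oo --> s.
Proof.
move=> u0 uM; exists (limn (fun n => \sum_(i < n) u i)).
apply: nondecreasing_is_cvgn.
- apply/nondecreasing_seqP => n; by rewrite big_ord_recr/= lerDl.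
- by exists M => _ [n _ <-].
Qed.

(** The real and imaginary parts are dominated by the modulus, so both are absolutely convergent
    real series. *)
Lemma abs_bound_converges c M : abs_bound c M -> exists l, converges c l.
Proof.
move=> cM.
have H (p : C -> R) : (forall z, `|p z| <= cabs z) ->
    exists s : R, (fun n => \sum_(i < n) p (c i)) @ \oo --> s.
  move=> pz; have h : cvgn (series (p \o c)).
    apply: normed_cvg; apply: nondecreasing_is_cvgn.
    - by apply: nondecreasing_series => n _ _; apply: normr_ge0.
    - exists M => _ [n _ <-] /=; rewrite [X in X n]seriesEord/=.
      by apply: le_trans (cM n); apply: ler_sum.
  exists (limn (series (p \o c))).
  rewrite (_ : (fun n => _) = series (p \o c))//.
  by apply/funext => n; rewrite seriesEord.
have [x hx] := H _ Re_le_cabs; have [y hy] := H _ Im_le_cabs.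
exists (x +i* y).
apply: (@squeeze0 _ (fun n => `|\sum_(i < n) complex.Re (c i) - x|
   + `|\sum_(i < n) complex.Im (c i) - y|)).
- by move=> n; apply: cabs_ge0.
- move=> n; apply: le_trans (cabs_le_ReIm _) _.
  by rewrite !raddfB/= !raddf_sum.
- rewrite -[0 in X in _ --> X](addr0 (0:R)).
  by apply: cvgD; apply: cvg_dist_lim.
Qed.

End Series.

(** * Double series, Cauchy products and dominated convergence *)

Section DoubleSeries.
Context {R : realType}.
Local Notation C := R[i].

Lemma triangle_sum {V : nmodType} (x : nat -> nat -> V) n :
  \sum_(m < n) \sum_(i < m.+1) x i (m - i)%N = \sum_(i < n) \sum_(j < n - i) x i j.
Proof.
elim: n => [|n IH]; first by rewrite !big_ord0.
rewrite big_ord_recr/= IH [in RHS]big_ord_recr/= subSnn big_ord1.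
rewrite [in X in _ + X]big_ord_recr/= subnn addrA; congr (_ + _).
rewrite -big_split/=; apply: eq_bigr => i _.
by rewrite subSn ?big_ord_recr// ltnW.
Qed.

Definition square_bound (x : nat -> nat -> C) (M : R) : Prop :=
  forall n, \sum_(i < n) \sum_(j < n) cabs (x i j) <= M.

Lemma square_split {V : nmodType} (x : nat -> nat -> V) n (h : nat -> nat) :
  (forall i, (i < n)%N -> (h i <= n)%N) ->
  \sum_(i < n) \sum_(j < n) x i j =
  \sum_(i < n) \sum_(j < h i) x i j + \sum_(i < n) \sum_(h i <= j < n) x i j.
Proof.
move=> hn; rewrite -big_split/=; apply: eq_bigr => i _.
rewrite -(big_mkord xpredT (fun j => x i j)) -(big_mkord xpredT (fun j => x i j)).
by rewrite -big_cat_nat//= hn.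
Qed.

Lemma triangle_le_square (u : nat -> nat -> R) n : (forall i j, 0 <= u i j) ->
  \sum_(i < n) \sum_(j < n - i) u i j <= \sum_(i < n) \sum_(j < n) u i j.
Proof.
move=> u0; rewrite (square_split u n (fun i => n - i)%N) ?lerDl; last first.
  by move=> i _; rewrite leq_subr.
by apply: sumr_ge0 => i _; apply: sumr_ge0.
Qed.

Lemma half_square_le_triangle (u : nat -> nat -> R) n : (forall i j, 0 <= u i j) ->
  \sum_(i < n./2) \sum_(j < n./2) u i j <= \sum_(i < n) \sum_(j < n - i) u i j.
Proof.
move=> u0; have hn : (n./2 <= n)%N by lia.
rewrite -(big_mkord xpredT (fun i => \sum_(j < n - i) u i j)).
rewrite (big_cat_nat (leq0n _) hn)//= big_mkord ler_wpDr ?sumr_ge0//.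
  by move=> i _; apply: sumr_ge0.
apply: ler_sum => i _; have hi : (n./2 <= n - i)%N by have := ltn_ord i; lia.
rewrite -(big_mkord xpredT (fun j => u i j)) -(big_mkord xpredT (fun j => u i j)).
by rewrite (big_cat_nat (leq0n _) hi)//= lerDl sumr_ge0.
Qed.

Lemma half_cvg : (fun n => n./2) @ \oo --> \oo.
Proof.
move=> A [N _ NA]; exists N.*2 => // n /= Nn; apply: NA => /=.
by rewrite -(doubleK N) half_leq.
Qed.

Lemma square_cvg (u : nat -> nat -> R) M : (forall i j, 0 <= u i j) ->
  (forall n, \sum_(i < n) \sum_(j < n) u i j <= M) ->
  exists s : R, (fun n => \sum_(i < n) \sum_(j < n) u i j) @ \oo --> s.
Proof.
move=> u0 uM; exists (limn (fun n => \sum_(i < n) \sum_(j < n) u i j)).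
apply: nondecreasing_is_cvgn; last by exists M => _ [n _ <-].
apply/nondecreasing_seqP => n; rewrite big_ord_recr/= ler_wpDr ?sumr_ge0//.
by apply: ler_sum => i _; rewrite big_ord_recr/= lerDl.
Qed.

(** The triangle [i + j < n] contains the square of side [n./2], so what the square of side [n] has
    in excess of the triangle is at most [S n - S n./2]. Both terms tend to the same limit [s]. *)
Lemma square_triangle (x : nat -> nat -> C) M : square_bound x M ->
  (fun n => cabs (\sum_(i < n) \sum_(j < n) x i j -
     \sum_(m < n) \sum_(i < m.+1) x i (m - i)%N)) @ \oo --> (0 : R).
Proof.
move=> xM; pose S n := \sum_(i < n) \sum_(j < n) cabs (x i j).
have x0 i j : 0 <= cabs (x i j) by apply: cabs_ge0.
have [s Ss] := square_cvg (fun i j => cabs (x i j)) M x0 xM.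
apply: (@squeeze0 _ _ (fun n => S n - S n./2)) => [n|n|].
- exact: cabs_ge0.
- rewrite triangle_sum (square_split _ _ (fun i => n - i)%N) => [|i _]; last exact: leq_subr.
  rewrite addrC addKr lerBrDr.
  apply: (@le_trans _ _ (\sum_(i < n) \sum_(n - i <= j < n) cabs (x i j) +
      \sum_(i < n) \sum_(j < n - i) cabs (x i j))); last first.
    rewrite /S (square_split (fun i j => cabs (x i j)) n (fun i => n - i)%N) 1?addrC//.
    by move=> i _; exact: leq_subr.
  apply: lerD; last exact: (half_square_le_triangle (fun i j => cabs (x i j))).
  apply: le_trans (cabs_sum _ _ _ _) _.
  by apply: ler_sum => i _; apply: cabs_sum.
- rewrite -(subrr s); apply: cvgB => //.
  exact: (cvg_comp _ _ half_cvg Ss).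
Qed.

Lemma square_bound_triangle (x : nat -> nat -> C) M : square_bound x M ->
  abs_bound (fun m => \sum_(i < m.+1) x i (m - i)%N) M.
Proof.
move=> xM n; apply: le_trans (xM n).
apply: le_trans (triangle_le_square (fun i j => cabs (x i j)) n _); last first.
  by move=> i j; apply: cabs_ge0.
rewrite -(triangle_sum (fun i j => cabs (x i j))).
by apply: ler_sum => i _; apply: cabs_sum.
Qed.

Definition cauchy_mul {A : nzRingType} (a b : nat -> A) (n : nat) : A :=
  \sum_(i < n.+1) a i * b (n - i)%N.

Lemma square_bound_mul (a b : nat -> C) Ma Mb : abs_bound a Ma -> abs_bound b Mb ->
  square_bound (fun i j => a i * b j) (Ma * Mb).
Proof.
move=> aM bM n; under eq_bigr do under eq_bigr do rewrite cabsM.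
under eq_bigr do rewrite -mulr_sumr.
rewrite -mulr_suml ler_pM// sumr_ge0// => i _; exact: cabs_ge0.
Qed.

Lemma cauchy_mul_abs_bound (a b : nat -> C) Ma Mb : abs_bound a Ma -> abs_bound b Mb ->
  abs_bound (cauchy_mul a b) (Ma * Mb).
Proof.
by move=> aM bM; apply: (square_bound_triangle (fun i j => a i * b j)); apply: square_bound_mul.
Qed.

Lemma bounded_mul0 (u v : nat -> R) M : (forall n, 0 <= u n <= M) -> (forall n, 0 <= v n) ->
  v @ \oo --> (0 : R) -> (fun n => u n * v n) @ \oo --> (0 : R).
Proof.
move=> uM v0 vl; apply: (@squeeze0 _ _ (fun n => M * v n)).
- by move=> n; apply: mulr_ge0 => //; have /andP[] := uM n.
- by move=> n; rewrite ler_wpM2r//; have /andP[] := uM n.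
- by rewrite -(mulr0 M); apply: cvgMr.
Qed.

Lemma partial_sum_bounded (c : nat -> C) M : abs_bound c M ->
  forall n, 0 <= cabs (\sum_(i < n) c i) <= M.
Proof. by move=> cM n; rewrite cabs_ge0/=; apply: le_trans (cM n); apply: cabs_sum. Qed.

(** With [A] and [B] the partial sums, [A B - l k = A (B - k) + k (A - l)] tends to 0. The partial
    sum of the Cauchy product is a triangle, which [square_triangle] compares with the square
    [A B]. *)
Lemma cauchy_mul_converges (a b : nat -> C) Ma Mb l k :
  abs_bound a Ma -> abs_bound b Mb -> converges a l -> converges b k ->
  converges (cauchy_mul a b) (l * k).
Proof.
move=> aM bM al bk; have h := square_triangle _ _ (square_bound_mul _ _ _ _ aM bM).
have l1 : (fun n => cabs (\sum_(i < n) a i) * cabs (\sum_(i < n) b i - k)) @ \oo --> (0:R).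
  by apply: (bounded_mul0 _ _ Ma) => // n; [exact: partial_sum_bounded | exact: cabs_ge0].
have l2 : (fun n => cabs k * cabs (\sum_(i < n) a i - l)) @ \oo --> (0:R).
  apply: (bounded_mul0 _ _ (cabs k)) => // n; last exact: cabs_ge0.
  by rewrite cabs_ge0/=.
apply: (@squeeze0 _ _ (fun n => cabs (\sum_(i < n) a i) * cabs (\sum_(i < n) b i - k) +
    cabs k * cabs (\sum_(i < n) a i - l) +
    cabs (\sum_(i < n) \sum_(j < n) a i * b j - \sum_(m < n) cauchy_mul a b m))) => [n|n|].
- exact: cabs_ge0.
- rewrite /= -!cabsM [X in _ <= _ + X]cabsBC.
apply: le_trans (lerD (cabsD _ _) (lexx _)); apply: le_trans (cabsD _ _).
rewrite le_eqVlt; apply/orP; left; apply/eqP; congr cabs.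
under [in X in _ = _ + (_ - X)]eq_bigr do rewrite -mulr_sumr.
rewrite -mulr_suml /cauchy_mul.
move: (\sum_(i < n) a i) (\sum_(j < n) b j) => u v; ring.
- rewrite -[0 in X in _ --> X](addr0 (0:R)) -[X in _ --> X + _](addr0 (0:R)).
  by apply: cvgD => //; apply: cvgD.
Qed.

(** Tannery's theorem, with the range of summation growing along with the parameter [n]. The sum is
    cut at a fixed [K] beyond which the tail of [m] is below [e / 2]; the [K] first terms tend to 0
    one by one. *)
Lemma tannery (d : nat -> nat -> R) (m : nat -> R) M :
  (forall k n, 0 <= d k n <= m k) -> (forall n, \sum_(k < n) m k <= M) ->
  (forall k, d k @ \oo --> (0 : R)) ->
  (fun n => \sum_(k < n) d k n) @ \oo --> (0 : R).
Proof.
move=> dm mM dl.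
have m0 k : 0 <= m k by have /andP[h1 h2] := dm k 0%N; apply: le_trans h2.
have [s ms] := real_series_cvg m M m0 mM.
have mle n : \sum_(k < n) m k <= s.
  rewrite -(cvg_lim (@Rhausdorff R) ms).
  apply: (@nondecreasing_cvgn_le _ (fun n => \sum_(k < n) m k)); last by apply: cvgP ms.
  by apply/nondecreasing_seqP => i; rewrite big_ord_recr/= lerDl.
apply/cvgr0Pnorm_lt => e e0.
have e2 : 0 < e / 2 by rewrite divr_gt0.
have [K _ HK] : \forall n \near \oo, s - e / 2 < \sum_(k < n) m k.
  by apply: (cvgr_gt s) => //; rewrite ltrBlDr ltrDl.
have hK : (fun n => \sum_(k < K) d k n) @ \oo --> (0 : R).
  elim: (K) => [|L IH].
    rewrite (_ : (fun n => _) = cst 0); first exact: cvg_cst.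
    by apply/funext => n; rewrite big_ord0.
  rewrite (_ : (fun n => _) = (fun n => \sum_(k < L) d k n + d L n)).
    by rewrite -[0 in X in _ --> X](addr0 (0:R)); apply: cvgD.
  by apply/funext => n; rewrite big_ord_recr.
near=> n.
have Kn : (K <= n)%N by near: n; exists K.
rewrite ger0_norm; last by apply: sumr_ge0 => k _; have /andP[] := dm k n.
rewrite -(big_mkord xpredT (fun k => d k n)) (big_cat_nat (leq0n _) Kn)//= big_mkord.
have -> : e = e / 2 + e / 2 by field.
apply: ler_ltD; last first.
  apply: (@le_lt_trans _ _ (\sum_(K <= k < n) m k)).
    by apply: ler_sum => k _; have /andP[] := dm k n.
  have := mle n; rewrite -(big_mkord xpredT m) (big_cat_nat (leq0n _) Kn)//= big_mkord.
  have := HK K (leqnn K); rewrite /=; lra.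
apply: ltW; near: n; apply: (cvgr_lt (0 : R)) => //.
Unshelve. all: by end_near. Qed.

End DoubleSeries.

(** * Composition of one-variable power series *)

Section Composition.
Context {R : realType}.
Local Notation C := R[i].

Definition cone {A : nzRingType} (n : nat) : A := (n == 0%N)%:R.

Definition cpow {A : nzRingType} (b : nat -> A) (k : nat) : nat -> A :=
  iter k (cauchy_mul b) cone.

(** Meaningful when [b 0 = 0]: then the [k]-th power of [b] starts in degree [k], so the sum may
    stop at [k = n]. *)
Definition comp_series {A : nzRingType} (a b : nat -> A) (n : nat) : A :=
  \sum_(k < n.+1) a k * cpow b k n.

Lemma sum_widen0 {V : nmodType} (u : nat -> V) n m :
  (n <= m)%N -> (forall k, (n <= k)%N -> u k = 0) -> \sum_(k < n) u k = \sum_(k < m) u k.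
Proof.
move=> nm u0; rewrite -(subnKC nm) [RHS]big_split_ord/= [X in _ = _ + X]big1 ?addr0// => i _.
by rewrite u0// leq_addr.
Qed.

Lemma cpow_eq0 {A : nzRingType} (b : nat -> A) k n : b 0%N = 0 -> (n < k)%N -> cpow b k n = 0.
Proof.
move=> b0; elim: k n => // k IH n nk; rewrite /cpow/= /cauchy_mul.
rewrite big_ord_recl b0 mul0r add0r big1// => i _.
by rewrite [X in _ * X]IH ?mulr0// lift0; have := ltn_ord i; lia.
Qed.

Lemma cone_converges : converges (@cone C) 1.
Proof.
have := converges_finite (@cone C) 1; rewrite big_ord1; apply => n n1.
by rewrite /cone; case: n n1.
Qed.

Lemma cone_abs_bound : abs_bound (@cone C) 1.
Proof.
case=> [|n]; first by rewrite big_ord0.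
by rewrite big_ord_recl/= cabs1 big1 ?addr0// => i _; rewrite cabs0.
Qed.

Lemma cpow_abs_bound (b : nat -> C) beta k :
  abs_bound b beta -> abs_bound (cpow b k) (beta ^+ k).
Proof.
move=> bb; elim: k => [|k IH]; first exact: cone_abs_bound.
by rewrite exprS; apply: cauchy_mul_abs_bound.
Qed.

Lemma cpow_converges (b : nat -> C) beta l k :
  abs_bound b beta -> converges b l -> converges (cpow b k) (l ^+ k).
Proof.
move=> bb bl; elim: k => [|k IH]; first exact: cone_converges.
rewrite exprS; apply: (cauchy_mul_converges _ _ beta (beta ^+ k)) => //; exact: cpow_abs_bound.
Qed.

(** Since [cpow b k m] vanishes for [k > m], every inner sum extends to [k < n], after which the two
    sums can be exchanged. *)
Lemma comp_partial_sum {A : nzRingType} (a b : nat -> A) n : b 0%N = 0 ->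
  \sum_(m < n) comp_series a b m = \sum_(k < n) a k * \sum_(m < n) cpow b k m.
Proof.
move=> b0; under [RHS]eq_bigr do rewrite mulr_sumr.
rewrite exchange_big/=; apply: eq_bigr => m _.
apply: (sum_widen0 (fun k => a k * cpow b k m)) => // k mk.
by rewrite cpow_eq0// mulr0.
Qed.

Section Bounds.
Variables (a b : nat -> C) (beta M : R) (l s : C).
Hypotheses (b0 : b 0%N = 0) (bb : abs_bound b beta) (bl : converges b l).
Hypotheses (aM : abs_bound (fun k => a k * (beta ^+ k)%:C) M)
           (as_ : converges (fun k => a k * l ^+ k) s).

Let beta0 : 0 <= beta. Proof. exact: abs_bound_ge0 bb. Qed.

Let am k : cabs (a k * (beta ^+ k)%:C) = cabs (a k) * beta ^+ k.
Proof. by rewrite cabsM cabsR ger0_norm// exprn_ge0. Qed.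

Lemma comp_abs_bound : abs_bound (comp_series a b) M.
Proof.
move=> n; apply: (le_trans _ (aM n)).
apply: (@le_trans _ _ (\sum_(m < n) \sum_(k < n) cabs (a k) * cabs (cpow b k m))).
  apply: ler_sum => m _; rewrite /comp_series.
  rewrite (sum_widen0 (fun k => a k * cpow b k m) m.+1 n)// => [|k mk]; last first.
    by rewrite cpow_eq0// mulr0.
  by apply: le_trans (cabs_sum _ _ _ _) _; apply: ler_sum => k _; rewrite cabsM.
rewrite exchange_big/=; apply: ler_sum => k _; rewrite am -mulr_sumr.
by rewrite ler_wpM2l ?cabs_ge0//; apply: cpow_abs_bound.
Qed.

(** By [comp_partial_sum] the partial sums are those of [a k * l ^+ k], with [l ^+ k] replaced by a
    partial sum of the [k]-th power of [b]. Each replacement error tends to 0, and [tannery] sums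
    the errors. *)
Lemma comp_converges : converges (comp_series a b) s.
Proof.
pose d k n := cabs (a k * (\sum_(m < n) cpow b k m - l ^+ k)).
have lb : cabs l <= beta by apply: partial_sum_le bb.
have T : (fun n => \sum_(k < n) d k n) @ \oo --> (0 : R).
  (* The factor 2 counts one [beta ^+ k] for the partial sum of [cpow b k] and one for [l ^+ k], as
     [cabs l <= beta]. *)
  apply: (tannery d (fun k => cabs (a k * (beta ^+ k)%:C) * 2) (M * 2)).
  - move=> k n; rewrite cabs_ge0/= /d am cabsM -mulrA ler_wpM2l ?cabs_ge0//.
    rewrite mulr2n mulrDr mulr1; apply: le_trans (cabsD _ _) _; apply: lerD.
      apply: le_trans (cabs_sum _ _ _ _) _; exact: cpow_abs_bound.
    by rewrite cabsN cabsX lerXn2r// nnegrE ?cabs_ge0.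
  - by move=> n; rewrite -mulr_suml ler_wpM2r.
  - move=> k.
    have -> : d k = fun n => cabs (\sum_(m < n) a k * cpow b k m - a k * l ^+ k).
      by apply/funext => n; rewrite /d mulrBr -mulr_sumr.
    exact: convergesZ (cpow_converges b beta l k bb bl).
apply: (@squeeze0 _ _ (fun n => \sum_(k < n) d k n +
   cabs (\sum_(k < n) a k * l ^+ k - s))) => [n|n|].
- exact: cabs_ge0.
- rewrite comp_partial_sum//.
  apply: (le_trans _ (lerD (cabs_sum _ _ _ _) (lexx _))).
  apply: (le_trans _ (cabsD _ _)); rewrite le_eqVlt; apply/orP; left; apply/eqP.
  congr cabs; under [in RHS]eq_bigr do rewrite mulrBr.
  by rewrite sumrB addrA subrK.
- by rewrite -[0 in X in _ --> X](addr0 (0:R)); apply: cvgD.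
Qed.

End Bounds.
End Composition.

Arguments cpow : simpl never.

(** * The exponential series on the complex plane *)

Section Exponential.
Context {R : realType}.
Local Notation C := R[i].

Definition exp_coef (k : nat) : C := (k`!%:R)^-1.

Lemma exp_coefR k : exp_coef k = ((k`!%:R)^-1 : R)%:C.
Proof. by rewrite /exp_coef fmorphV/= rmorph_nat. Qed.

Lemma exp_abs_bound (r : R) : 0 <= r ->
  abs_bound (fun k => exp_coef k * (r ^+ k)%:C) (expR r).
Proof.
move=> r0 n.
have -> : \sum_(i < n) cabs (exp_coef i * (r ^+ i)%:C) = series (exp_coeff r) n.
  rewrite seriesEord/=; apply: eq_bigr => i _.
  rewrite exp_coefR -rmorphM cabsR ger0_norm /exp_coeff/= 1?mulrC//.
  by rewrite mulr_ge0// exprn_ge0.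
rewrite /expR; apply: nondecreasing_cvgn_le; last exact: is_cvg_series_exp_coeff.
apply: nondecreasing_series => i _ _; exact: exp_coeff_ge0.
Qed.

Lemma real_converges (u : nat -> R) (s : R) : series u @ \oo --> s ->
  converges (fun n => (u n)%:C) s%:C.
Proof.
move=> us; rewrite /converges.
rewrite (_ : (fun n => _) = (fun n => `|series u n - s|)); first exact: cvg_dist_lim.
by apply/funext => n; rewrite -rmorph_sum -rmorphB cabsR seriesEord.
Qed.

Lemma exp_converges_real (x : R) : converges (fun k => exp_coef k * x%:C ^+ k) (expR x)%:C.
Proof.
apply: (converges_ext (fun k => (exp_coeff x k)%:C)) => [k|].
  by rewrite exp_coefR -rmorphXn -rmorphM /exp_coeff/= mulrC.
by apply: real_converges; apply: is_cvg_series_exp_coeff.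
Qed.

(** The two components have the shape of the signs in [cos_coeff] and [sin_coeff], so that the
    exponential series at [i y] splits into these two. *)
Lemma expr_i (n : nat) : ('i%C : C) ^+ n =
  ((~~ odd n)%:R * (-1) ^+ n./2) +i* ((odd n)%:R * (-1) ^+ n.-1./2).
Proof.
have ii k : ('i%C : C) ^+ k.*2 = ((-1) ^+ k)%:C.
  by rewrite -muln2 mulnC exprM sqr_i rmorphXn rmorphN1.
rewrite -[in LHS](odd_double_half n) exprD ii; case: (boolP (odd n)) => on /=.
  have -> : n.-1./2 = n./2 by lia.
  rewrite expr1 mul0r mul1r; apply/eqP; rewrite eq_complex/=.
  by rewrite !(mul0r, mulr0, mul1r, add0r, oppr0) !eqxx.
by rewrite expr0 !mul1r mul0r.
Qed.

Lemma mulcR (x y r : R) : (x +i* y) * r%:C = (x * r) +i* (y * r).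
Proof. by apply/eqP; rewrite eq_complex/= !mulr0 subr0 add0r !eqxx. Qed.

Lemma exp_converges_imag (y : R) :
  converges (fun k => exp_coef k * ('i%C * y%:C) ^+ k) (cos y +i* sin y).
Proof.
have hc : converges (fun n => (cos_coeff y n)%:C) (cos y)%:C.
  by apply: real_converges; rewrite cos.unlock; exact: is_cvg_series_cos_coeff.
have hs : converges (fun n => (sin_coeff y n)%:C) (sin y)%:C.
  by apply: real_converges; rewrite sin.unlock; exact: is_cvg_series_sin_coeff.
have := convergesD _ _ _ _ hc (convergesZ 'i%C _ _ hs).
rewrite -(complexE (cos y +i* sin y)); apply: converges_ext => n.
transitivity (cos_coeff y n +i* sin_coeff y n).
  exact: esym (complexE (cos_coeff y n +i* sin_coeff y n)).
rewrite exprMn expr_i exp_coefR -rmorphXn [RHS]mulrC !mulcR.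
by rewrite !mulr0 subr0 add0r.
Qed.

Lemma exp_abs_boundC (z : C) : abs_bound (fun k => exp_coef k * z ^+ k) (expR (cabs z)).
Proof.
apply: abs_bound_le (exp_abs_bound _ (cabs_ge0 z)) => n.
by rewrite !cabsM cabsX cabsR ger0_norm// exprn_ge0// cabs_ge0.
Qed.

(** By the binomial formula the series at [x + i y] is the Cauchy product of the series at [x] and
    at [i y], whose sums are [expR x] and [cos y + i sin y]. *)
Lemma exp_converges (z : C) : converges (fun k => exp_coef k * z ^+ k) (cexp z).
Proof.
case: z => x y.
have := cauchy_mul_converges _ _ _ _ _ _ (exp_abs_boundC x%:C) (exp_abs_boundC ('i%C * y%:C))
  (exp_converges_real x) (exp_converges_imag y).
have -> : (expR x)%:C * (cos y +i* sin y) = cexp (x +i* y).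
  by rewrite mulrC mulcR /cexp/= ![_ * expR x]mulrC.
apply: converges_ext => n; rewrite /cauchy_mul [x +i* y]complexE/= addrC exprDn mulr_sumr.
apply: eq_bigr => i _.
have ilen : (i <= n)%N by rewrite -ltnS.
have f0 m : (m`!%:R : C) != 0 by rewrite pnatr_eq0 -lt0n fact_gt0.
rewrite /exp_coef -mulrnAr -(bin_fact ilen).
have := f0 (n - i)%N; have := f0 i; have : ('C(n, i)%:R : C) != 0.
  by rewrite pnatr_eq0 -lt0n bin_gt0.
by move=> c0 i0 d0; rewrite -mulr_natr !natrM; field; apply/and3P.
Qed.

End Exponential.

(** * Uniqueness of power series coefficients and of polynomials on the real plane *)

Section Uniqueness.
Context {R : realType}.
Local Notation C := R[i].

Lemma le0_of_small (x M : R) : (forall t : R, 0 < t <= 1 -> x <= t * M) -> x <= 0.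
Proof.
move=> h; rewrite leNgt; apply/negP => x0.
have M0 : 0 < M by have := h 1; rewrite ltr01 lexx mul1r => /(_ isT); apply: lt_le_trans.
(* This choice makes [t * M <= x / 2], which is below [x]. *)
pose t := Num.min 1 (x / (2 * M)).
have t0 : 0 < t by rewrite /t lt_min ltr01/= divr_gt0// mulr_gt0.
have := h t; rewrite t0 /t ge_min lexx/= => /(_ isT).
apply/negP; rewrite -ltNge; apply: (@le_lt_trans _ _ (x / (2 * M) * M)).
  by rewrite ler_pM2r// ge_min lexx orbT.
have -> : x / (2 * M) * M = x / 2 by field; rewrite gt_eqF.
by rewrite ltr_pdivrMr// ltr_pMr// ltr1n.
Qed.

(** Once the coefficients before [m] vanish, the term of degree [m] is balanced by the tail, of
    modulus at most [t ^+ m.+1 * M]. Dividing by [t ^+ m] and letting [t] tend to 0 gives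
    [e m = 0]. *)
Lemma power_series_eq0 (e : nat -> C) M : abs_bound e M ->
  (forall t : R, 0 < t <= 1 -> converges (fun n => e n * t%:C ^+ n) 0) ->
  forall n, e n = 0.
Proof.
move=> eM h; elim/ltn_ind => m IH; apply: cabs_eq0; apply/eqP.
rewrite eq_le cabs_ge0 andbT; apply: (le0_of_small _ M) => t /andP[t0 t1].
have ct n : cabs (t%:C ^+ n) = t ^+ n by rewrite cabsX cabsR gtr0_norm.
have ht := h t; rewrite t0 t1 in ht; have {}ht := ht isT.
suff : cabs (e m) * t ^+ m <= t * M * t ^+ m by rewrite ler_pM2r// exprn_gt0.
(* The alternative [n <= m] covers the partial sums that do not yet contain the term of degree [m];
   they do not affect the limit. *)
have key n : cabs (e m) * t ^+ m - cabs (\sum_(i < n) e i * t%:C ^+ i - 0)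
    <= t * M * t ^+ m \/ (n <= m)%N.
  case: (ltnP m n) => mn; [left|by right].
  rewrite subr0 -(big_mkord xpredT (fun i => e i * t%:C ^+ i)).
  rewrite (big_cat_nat (leq0n _) (ltnW mn))//= big_mkord big1 ?add0r; last first.
    by move=> i _; rewrite IH ?mul0r.
  rewrite big_ltn// -ct -cabsM.
  apply: (@le_trans _ _ (cabs (\sum_(m.+1 <= i < n) e i * t%:C ^+ i))).
    rewrite lerBlDl -[X in _ <= _ + X]cabsN; apply: le_trans (cabsD _ _).
    by rewrite addrK.
  apply: le_trans (cabs_sum _ _ _ _) _.
  rewrite ct mulrAC -exprS mulrC.
  apply: (@le_trans _ _ (\sum_(m.+1 <= i < n) cabs (e i) * t ^+ m.+1)).
    rewrite [leLHS]big_nat [leRHS]big_nat; apply: ler_sum => i /andP[mi _].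
    by rewrite cabsM ct ler_wpM2l ?cabs_ge0// ler_wiXn2l// ltW.
  rewrite -mulr_suml; apply: ler_wpM2r; first by rewrite exprn_ge0// ltW.
  apply: (le_trans _ (eM n)); rewrite -(big_mkord xpredT (fun i => cabs (e i))).
  rewrite [leRHS](big_cat_nat (leq0n _) mn)//= lerDr sumr_ge0// => i _; exact: cabs_ge0.
have lim : (fun n => cabs (e m) * t ^+ m - cabs (\sum_(i < n) e i * t%:C ^+ i - 0)) @ \oo -->
    (cabs (e m) * t ^+ m - 0).
  by apply: cvgB => //; apply: cvg_cst.
rewrite -[leLHS]subr0; apply: (cvgr_to_le lim); near=> n.
case: (key n) => // nm; suff : (m < n)%N by rewrite ltnNge nm.
by near: n; exists m.+1.
Unshelve. all: by end_near. Qed.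

(* A notion of polynomial in [(z, w)] whose closure under ring operations needs
   no bookkeeping of coefficients, and which still suffices for [line_poly_eq0]. *)
Definition line_poly (E : C -> C -> C) : Prop := forall z0 z1 w0 w1 : C,
  exists p : {poly C}, forall t, E (z0 + t * z1) (w0 + t * w1) = p.[t].

Lemma line_poly_cst c : line_poly (fun _ _ => c).
Proof. by move=> *; exists c%:P => t; rewrite hornerC. Qed.

Lemma line_poly_fst : line_poly (fun z _ => z).
Proof. by move=> z0 z1 w0 w1; exists (z0%:P + 'X * z1%:P) => t; rewrite !hornerE. Qed.

Lemma line_poly_snd : line_poly (fun _ w => w).
Proof. by move=> z0 z1 w0 w1; exists (w0%:P + 'X * w1%:P) => t; rewrite !hornerE. Qed.

Lemma line_polyD E G : line_poly E -> line_poly G -> line_poly (fun z w => E z w + G z w).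
Proof.
move=> hE hG z0 z1 w0 w1; have [p hp] := hE z0 z1 w0 w1; have [q hq] := hG z0 z1 w0 w1.
by exists (p + q) => t; rewrite hp hq hornerD.
Qed.

Lemma line_polyM E G : line_poly E -> line_poly G -> line_poly (fun z w => E z w * G z w).
Proof.
move=> hE hG z0 z1 w0 w1; have [p hp] := hE z0 z1 w0 w1; have [q hq] := hG z0 z1 w0 w1.
by exists (p * q) => t; rewrite hp hq hornerM.
Qed.

Lemma line_poly_ext E G : E =2 G -> line_poly E -> line_poly G.
Proof.
by move=> EG hE z0 z1 w0 w1; have [p hp] := hE z0 z1 w0 w1; exists p => t; rewrite -EG hp.
Qed.

Lemma line_polyX E n : line_poly E -> line_poly (fun z w => E z w ^+ n).
Proof.
move=> hE; elim: n => [|n IH]; first by apply: (line_poly_ext (fun _ _ => 1)) (line_poly_cst 1).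
by apply: line_poly_ext (line_polyM _ _ hE IH) => z w; rewrite exprS.
Qed.

Lemma line_poly_sum n (E : 'I_n -> C -> C -> C) : (forall i, line_poly (E i)) ->
  line_poly (fun z w => \sum_(i < n) E i z w).
Proof.
move=> hE z0 z1 w0 w1.
have [p hp] := choice (fun i => hE i z0 z1 w0 w1).
by exists (\sum_i p i) => t; rewrite horner_sum; apply: eq_bigr => i _; rewrite hp.
Qed.

(** The [size p] distinct points [d / (i + 2)] are roots, more than a nonzero [p] can have. *)
Lemma poly_eq0_of_small (p : {poly C}) (d : R) : 0 < d ->
  (forall t : R, `|t| < d -> p.[t%:C] = 0) -> p = 0.
Proof.
move=> d0 h; apply/eqP; apply: contraT => p0.
pose x (i : nat) : R := d / (i.+2)%:R.
have xd i : `|x i| < d.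
  rewrite gtr0_norm ?divr_gt0// /x ltr_pdivrMr// -[X in X < _]mulr1 ltr_pM2l//.
  by rewrite ltr1n.
pose s := [seq (x i)%:C | i <- iota 0 (size p)].
have : (size s < size p)%N.
  apply: max_poly_roots => //.
    by apply/allP => y /mapP[i _ ->]; apply/rootP; apply: h.
  rewrite map_inj_uniq ?iota_uniq// => i j /complexI /(mulfI (lt0r_neq0 d0)) /invr_inj.
  by move/eqP; rewrite eqr_nat => /eqP [].
by rewrite size_map size_iota ltnn.
Qed.

(* With [z = x + i y] and [w = x - i y], vanishing for real [x] and [y] extends
   to complex [x], then to complex [y]. *)
Lemma line_poly_eq0 (E : C -> C -> C) (d : R) : line_poly E -> 0 < d ->
  (forall z, cabs z < d -> E z z^* = 0) -> forall z w, E z w = 0.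
Proof.
move=> hE d0 h.
have d20 : 0 < d / 2 by rewrite divr_gt0.
have h1 (y : R) (x : C) : `|y| < d / 2 -> E ('i%C * y%:C + x) (- 'i%C * y%:C + x) = 0.
  move=> yd; have [p hp] := hE ('i%C * y%:C) 1 (- 'i%C * y%:C) 1.
  suff p0 : p = 0 by have := hp x; rewrite !mulr1 => ->; rewrite p0 horner0.
  apply: (poly_eq0_of_small p (d / 2)) => // t td; rewrite -hp !mulr1.
  have -> : - 'i%C * y%:C + t%:C = ('i%C * y%:C + t%:C)^*.
    by apply/eqP; rewrite eq_complex/=; apply/andP; split; apply/eqP; ring.
  apply: h; apply: le_lt_trans (cabsD _ _) _.
  rewrite cabsM !cabsR /cabs normc_def/= expr0n add0r expr1n sqrtr1 mul1r.
  lra.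
move=> z w; pose x := (z + w) / 2; pose y := (z - w) / (2 * 'i%C).
have i0 : ('i%C : C) != 0 by rewrite eq_complex/= oner_eq0 andbF.
have -> : z = x + y * 'i%C by rewrite /x /y; field.
have -> : w = x + y * (- 'i%C) by rewrite /x /y; field.
have [p hp] := hE x 'i%C x (- 'i%C); rewrite hp.
suff -> : p = 0 by rewrite horner0.
apply: (poly_eq0_of_small p (d / 2)) => // t td; rewrite -hp -(h1 t x td).
by congr E; ring.
Qed.

End Uniqueness.

(** * Termwise complex differentiation of power series *)

Section Derivative.
Context {R : realType}.
Local Notation C := R[i].

(** In the partial order of [R[i]], comparable elements have equal imaginary parts, so a positive
    element is real. *)
Lemma ltC_exists (e : C) : 0 < e -> exists2 r : R, 0 < r & e = r%:C.
Proof.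
by case: e => a b; rewrite ltcE/= => /andP[/eqP -> a0]; exists a.
Qed.

Lemma near0_exists (P : C -> Prop) : (\forall z \near (0 : C), P z) ->
  exists2 d : R, 0 < d & forall z, cabs z < d -> P z.
Proof.
move=> /nbhs_ballP[e /= e0 he]; have [d d0 ed] := ltC_exists e e0.
exists d => // z zd; apply: he; rewrite /ball/= sub0r normrN ed cabsE ltcR//.
Qed.

Lemma exists_near0 (P : C -> Prop) (d : R) : 0 < d ->
  (forall z, cabs z < d -> P z) -> \forall z \near (0 : C), P z.
Proof.
move=> d0 h; apply/nbhs_ballP; exists d%:C; first by rewrite /= ltcR.
by move=> z; rewrite /ball/= sub0r normrN cabsE ltcR => /h.
Qed.

Lemma lim_of_converges (u : nat -> C) (l : C) :
  (fun n => cabs (u n - l)) @ \oo --> (0 : R) -> lim (u @ \oo) = l.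
Proof.
move=> ul; apply: cvg_lim; first exact: norm_hausdorff.
apply/cvgrPdist_lt => e e0; have [r r0 ->] := ltC_exists e e0.
near=> n; rewrite cabsE ltcR cabsBC; near: n.
by apply: (cvgr_lt (0 : R)).
Unshelve. all: by end_near. Qed.

Lemma derivative_of_quadratic (h : C -> C) (z L : C) (d K : R) : 0 < d ->
  (forall k, cabs k < d -> cabs (h (k + z) - h z - k * L) <= K * cabs k ^+ 2) ->
  derivable h z 1 /\ derive1 h z = L.
Proof.
move=> d0 hK.
have cv : (fun k : C => k^-1 *: (h (k + z) - h z)) @ (0 : C)^' --> L.
  apply/cvgrPdist_lt => e e0; have [r r0 ->] := ltC_exists e e0.
  (* [K] may have any sign; the denominator is positive and still dominates [K]. *)
  pose d1 := Num.min d (r / (`|K| + 1)).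
  have K1 : 0 < `|K| + 1 by rewrite ltr_wpDl.
  have d10 : 0 < d1 by rewrite lt_min d0 divr_gt0.
  apply/nbhs_ballP; exists d1%:C; first by rewrite /= ltcR.
  move=> k; rewrite /ball/= sub0r normrN cabsE ltcR lt_min => /andP[kd kr] k0.
  rewrite cabsE ltcR.
  have ck0 : 0 < cabs k.
    by rewrite lt_neqAle cabs_ge0 andbT eq_sym; apply: contra_neq k0 => /cabs_eq0.
  have -> : L - k^-1 *: (h (k + z) - h z) = - (k^-1 * (h (k + z) - h z - k * L)).
    by rewrite /GRing.scale/=; field.
  rewrite cabsN cabsM -(ltr_pM2l ck0) mulrA -cabsM mulfV// cabs1 mul1r.
  apply: le_lt_trans (hK k kd) _; rewrite expr2 mulrCA ltr_pM2l//.
  apply: (@le_lt_trans _ _ ((`|K| + 1) * cabs k)).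
    by rewrite ler_wpM2r ?cabs_ge0// (le_trans (ler_norm K))// lerDl.
  by move: kr; rewrite ltr_pdivlMr// mulrC.
split; last by rewrite /derive1; apply: cvg_lim cv; exact: norm_hausdorff.
apply/cvg_ex; exists L; move: cv.
by under eq_fun do rewrite -[X in h (X + _)]mulr1.
Qed.

(** The remainders satisfy [D_(n+1) = (k + z) D_n + k^2 n z^(n-1)], and [n^2 + n <= (n + 1)^2]
    closes the induction. The factor [rho ^+ 2] on the left avoids the exponent [n - 2] on the
    right. *)
Lemma pow_second_order (z k : C) (rho : R) n : 0 < rho ->
  cabs z <= rho -> cabs (k + z) <= rho ->
  cabs ((k + z) ^+ n - z ^+ n - k * (n%:R * z ^+ n.-1)) * rho ^+ 2 <=
    cabs k ^+ 2 * (n ^ 2)%:R * rho ^+ n.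
Proof.
move=> r0 zr kzr; elim: n => [|n IH].
  by rewrite !expr0 subrr mul0r mulr0 subrr cabs0 mul0r mulr0 mul0r.
pose D := (k + z) ^+ n - z ^+ n - k * (n%:R * z ^+ n.-1).
have -> : (k + z) ^+ n.+1 - z ^+ n.+1 - k * (n.+1%:R * z ^+ n.+1.-1) =
    (k + z) * D + k ^+ 2 * (n%:R * z ^+ n.-1).
  rewrite /D; case: (n) => [|m]/=; first by rewrite !expr0 !expr1; ring.
  by rewrite !exprS -[m.+2%:R]natr1 -[m.+1%:R]natr1; ring.
have zn : cabs (n%:R * z ^+ n.-1) * rho ^+ 2 <= n%:R * rho ^+ n.+1.
  case: (n) => [|m]; first by rewrite !mul0r cabs0 mul0r.
  rewrite cabsM cabsX -(rmorph_nat (@real_complex R)) cabsR normr_nat/=.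
  have -> : rho ^+ m.+2 = rho ^+ m * rho ^+ 2 by rewrite -exprD addn2.
  rewrite -mulrA; apply: ler_wpM2l => //; apply: ler_wpM2r; first exact: sqr_ge0.
  by rewrite lerXn2r// nnegrE ?cabs_ge0// ltW.
apply: (@le_trans _ _ (rho * (cabs D * rho ^+ 2) +
    cabs k ^+ 2 * (cabs (n%:R * z ^+ n.-1) * rho ^+ 2))).
  rewrite [rho * _]mulrA [cabs k ^+ 2 * _]mulrA -mulrDl.
  apply: ler_wpM2r; first exact: sqr_ge0.
  apply: (le_trans (cabsD _ _)); rewrite [cabs ((k + z) * D)]cabsM [cabs (k ^+ 2 * _)]cabsM cabsX.
  by rewrite lerD2r; apply: ler_wpM2r => //; apply: cabs_ge0.
apply: (@le_trans _ _ (rho * (cabs k ^+ 2 * (n ^ 2)%:R * rho ^+ n) +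
   cabs k ^+ 2 * (n%:R * rho ^+ n.+1))).
  by apply: lerD; apply: ler_wpM2l => //; [exact: ltW | exact: sqr_ge0].
rewrite mulrCA -exprS [cabs k ^+ 2 * (n%:R * _)]mulrA -mulrDl.
apply: ler_wpM2r; first by rewrite exprn_ge0// ltW.
rewrite -mulrDr; apply: ler_wpM2l; first exact: sqr_ge0.
by rewrite -natrD ler_nat; lia.
Qed.

(** Absorbs the factor [n ^ 2] of [pow_second_order] when the radius grows from [rho] to [4 rho]. *)
Lemma sqr_le_exp4 n : (n ^ 2 <= 4 ^ n)%N.
Proof.
by elim: n => // n; rewrite -!mulnn expnS; have := expn_gt0 4 n; move: (4 ^ n)%N => e; nia.
Qed.

Variables (c : nat -> C) (r M : R) (h : C -> C).
Hypotheses (r0 : 0 < r) (cM : abs_bound (fun n => c n * (r ^+ n)%:C) M).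
Hypothesis hc : forall z, cabs z <= r -> converges (fun n => c n * z ^+ n) (h z).

Let cabs_term n : cabs (c n * (r ^+ n)%:C) = cabs (c n) * r ^+ n.
Proof. by rewrite cabsM cabsR ger0_norm// exprn_ge0// ltW. Qed.

(** With [rho = r / 4], the termwise remainders are at most [cabs k ^+ 2 / rho ^+ 2] times the terms
    of the series at radius [r]. Their sum is thus quadratic in [k]; the radius [r / 8] for both [z]
    and [k] keeps [k + z] within [rho]. *)
Lemma power_series_derivable z : cabs z < r / 8 ->
  exists2 L, converges (fun n => c n * (n%:R * z ^+ n.-1)) L &
    derivable h z 1 /\ derive1 h z = L.
Proof.
move=> zr; have [rho rE] : exists rho, r = 4%:R * rho by exists (r / 4); field.
have rho0 : 0 < rho by move: r0 rE; lra.
have zrho : cabs z <= rho by move: zr rE r0; lra.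
have bd : abs_bound (fun n => c n * (n%:R * z ^+ n.-1)) (rho^-1 * M).
  apply: (abs_bound_le _ (fun n => (rho^-1)%:C * (c n * (r ^+ n)%:C))).
    move=> n; rewrite cabsM [leRHS]cabsM cabs_term cabsR gtr0_norm ?invr_gt0//.
    rewrite [leRHS]mulrCA; apply: ler_wpM2l; first exact: cabs_ge0.
    rewrite -(ler_pM2l rho0) mulrA mulfV ?gt_eqF// mul1r.
    rewrite cabsM.
    case: n => [|n]; first by rewrite cabs0 !mul0r mulr0 expr0.
    rewrite cabsX -(rmorph_nat (@real_complex R)) cabsR normr_nat/= mulrCA.
    apply: (@le_trans _ _ (n.+1%:R * rho ^+ n.+1)).
      rewrite exprS; apply: ler_wpM2l => //; apply: ler_wpM2l; first exact: ltW.
      by rewrite lerXn2r// nnegrE ?cabs_ge0// ltW.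
    rewrite rE.
    rewrite exprMn; apply: ler_wpM2r; first by rewrite exprn_ge0// ltW.
    rewrite -natrX ler_nat.
    have := sqr_le_exp4 n.+1; nia.
  have := abs_boundZ (rho^-1)%:C _ _ cM.
  by rewrite cabsR gtr0_norm ?invr_gt0.
have [L hL] := abs_bound_converges _ _ bd; exists L => //.
apply: (derivative_of_quadratic h z L (r / 8) (M / rho ^+ 2)) => [|k kr].
  by rewrite divr_gt0.
have kz : cabs (k + z) <= rho.
  by apply: le_trans (cabsD _ _) _; move: zrho kr rE; lra.
have rr : rho <= r by move: rE rho0; lra.
have := convergesB _ _ _ _ (convergesB _ _ _ _ (hc (k + z) (le_trans kz rr))
   (hc z (le_trans zrho rr))) (convergesZ k _ _ hL).
move=> /partial_sum_le; apply.
apply: (abs_bound_le _ (fun n => (cabs k ^+ 2 / rho ^+ 2)%:C * (c n * (r ^+ n)%:C))); last first.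
  have := abs_boundZ (cabs k ^+ 2 / rho ^+ 2)%:C _ _ cM.
  rewrite cabsR ger0_norm ?divr_ge0 ?sqr_ge0// => hb.
  by have -> : M / rho ^+ 2 * cabs k ^+ 2 = cabs k ^+ 2 / rho ^+ 2 * M by ring.
move=> n; rewrite [leRHS]cabsM cabs_term cabsR ger0_norm ?divr_ge0 ?sqr_ge0//.
have -> : c n * (k + z) ^+ n - c n * z ^+ n - k * (c n * (n%:R * z ^+ n.-1)) =
  c n * ((k + z) ^+ n - z ^+ n - k * (n%:R * z ^+ n.-1)) by ring.
rewrite cabsM [leRHS]mulrCA; apply: ler_wpM2l; first exact: cabs_ge0.
rewrite mulrAC ler_pdivlMr ?exprn_gt0//.
apply: le_trans (pow_second_order z k rho n rho0 zrho kz) _.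
rewrite -mulrA; apply: ler_wpM2l; first exact: sqr_ge0.
rewrite rE.
rewrite exprMn; apply: ler_wpM2r; first by rewrite exprn_ge0// ltW.
by rewrite -natrX ler_nat sqr_le_exp4.
Qed.

Lemma power_series_derive0 : derive1 h 0 = c 1%N.
Proof.
have [|L hL [_ ->]] := power_series_derivable 0; first by rewrite cabs0 divr_gt0.
apply: converges_unique hL _.
have -> : c 1%N = \sum_(i < 2) c i * (i%:R * 0 ^+ i.-1).
  by rewrite big_ord_recl big_ord1/= mul0r mulr0 add0r mul1r expr0 mulr1.
apply: (converges_finite (fun n => c n * (n%:R * 0 ^+ n.-1))) => -[|[|n]]// _.
by rewrite /= expr0n/= !mulr0.
Qed.

End Derivative.

(** * No power of [lam] is 1 *)

Section Nonresonance.
Context {R : realType}.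
Local Notation C := R[i].

Lemma sin_eq0_shift (x : R) (k : int) : sin (x + k%:~R * pi) = 0 -> sin x = 0.
Proof.
have H n (y : R) : (sin (y + n%:R * pi) == 0) = (sin y == 0).
  elim: n => [|n IH]; first by rewrite mul0r addr0.
  by rewrite -natr1 mulrDl mul1r addrA sinDpi oppr_eq0.
case: k => n; first by move/eqP; rewrite -pmulrn H => /eqP.
by rewrite NegzE rmorphN/= -pmulrn mulNr => /eqP; rewrite -(H n.+1) subrK => /eqP.
Qed.

Lemma e2piiR (x : R) : e2pii x%:C = cos (2 * pi * x) +i* sin (2 * pi * x).
Proof. by rewrite /e2pii/cexp/= !(mul0r, mulr0, oppr0, subr0, addr0, add0r) expR0 !mul1r. Qed.

Lemma cis_exp (t : R) n : (cos t +i* sin t) ^+ n = cos (t *+ n) +i* sin (t *+ n).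
Proof.
elim: n => [|n IH]; first by rewrite expr0 mulr0n cos0 sin0.
by rewrite exprS IH mulrS cosD sinD [sin t * cos _ + _]addrC.
Qed.

(** If the power is 1, then [cos (2 pi n omega) = 1], so [sin (pi n omega) = 0]. Removing the
    integer part leaves an angle in [[0, pi)], where the sine vanishes only at 0; so [n omega] is an
    integer and [omega] is rational. *)
Lemma e2pii_pow_neq1 (omega : R) n : irrational omega -> (0 < n)%N ->
  e2pii omega%:C ^+ n != 1.
Proof.
move=> irr n0; apply/eqP; rewrite e2piiR cis_exp => -[cos1 _].
apply: irr; apply/rationalP.
pose x := omega *+ n; pose k := Num.floor x; exists k, n.
have pi0 : 0 < pi :> R := pi_gt0 R.
have sx : sin (x * pi) = 0.
  apply/eqP; rewrite -sqrf_eq0; apply/eqP; move: cos1.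
  have -> : (2 * pi * omega) *+ n = (x * pi) *+ 2 by rewrite /x -mulrnAr mulr_natl; ring.
  by rewrite cos_mulr2n cos2sin2; lra.
have /sin_eq0_shift s0 : sin ((x - k%:~R) * pi + k%:~R * pi) = 0 by rewrite -mulrDl subrK.
have th0 : 0 <= x - k%:~R by rewrite subr_ge0 floor_le_tmp.
have th1 : x - k%:~R < 1 by rewrite ltrBlDl -intrD1 floorD1_gt.
have th : x - k%:~R = 0.
  apply/eqP; rewrite eq_le th0 andbT leNgt; apply/negP => th.
  suff : 0 < sin ((x - k%:~R) * pi) by rewrite s0 ltxx.
  by apply: sin_gt0_pi; rewrite mulr_gt0//= gtr_pMl.
have <- : x = k%:~R by apply/eqP; rewrite -subr_eq0 th.
by rewrite /x -[omega *+ n]mulr_natr mulfK// pnatr_eq0 -lt0n.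
Qed.

Lemma e2pii_conj (omega : R) : (e2pii omega%:C)^* * e2pii omega%:C = 1.
Proof.
rewrite e2piiR; apply/eqP; rewrite eq_complex/=; apply/andP; split; apply/eqP.
  by rewrite mulNr opprK -!expr2 cos2Dsin2.
by rewrite mulNr [sin _ * _]mulrC subrr.
Qed.

End Nonresonance.

(** * Formal conjugacy on the line [w = 0] *)

Section FormalRestriction.
Context {R : realType}.
Local Notation C := R[i].
Implicit Types (a b : fps2 R).

Lemma cauchy_mul_ext {A : nzRingType} (a a' b b' : nat -> A) : a =1 a' -> b =1 b' ->
  cauchy_mul a b =1 cauchy_mul a' b'.
Proof. by move=> /funext -> /funext ->. Qed.

Lemma cauchy_mul1 {A : nzRingType} (a : nat -> A) : cauchy_mul a cone =1 a.
Proof.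
move=> n; rewrite /cauchy_mul big_ord_recr/= subnn mulr1 big1 ?add0r// => i _.
by rewrite /cone subn_eq0 leqNgt ltn_ord mulr0.
Qed.

Lemma cauchy_1mul {A : nzRingType} (a : nat -> A) : cauchy_mul cone a =1 a.
Proof.
move=> n; rewrite /cauchy_mul big_ord_recl/= subn0 mul1r big1 ?addr0// => i _.
by rewrite /cone mul0r.
Qed.

Lemma cauchy_mul0 {A : nzRingType} (a b : nat -> A) : (forall n, b n = 0) ->
  forall n, cauchy_mul a b n = 0.
Proof. by move=> b0 n; apply: big1 => i _; rewrite b0 mulr0. Qed.

Lemma cauchy_0mul {A : nzRingType} (a b : nat -> A) n : (forall i, (i <= n)%N -> a i = 0) ->
  cauchy_mul a b n = 0.
Proof. by move=> a0; apply: big1 => i _; rewrite a0 ?mul0r// -ltnS. Qed.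

Lemma cpow_zero {A : nzRingType} (b : nat -> A) : (forall n, b n = 0) ->
  forall k n, cpow b k.+1 n = 0.
Proof. by move=> b0 k n; apply: big1 => i _; rewrite b0 mul0r. Qed.

Lemma cpow_diag {A : nzRingType} (b : nat -> A) k : b 0%N = 0 -> cpow b k k = b 1%N ^+ k.
Proof.
move=> b0; elim: k => [|k IH] //; rewrite exprS -IH /cpow/= /cauchy_mul.
rewrite big_ord_recl b0 mul0r add0r big_ord_recl/= subSS subn0 big1 ?addr0// => i _.
by rewrite [X in _ * X](cpow_eq0 b k)// ?mulr0// /bump/=; have := ltn_ord i; lia.
Qed.

Lemma cpow1 {A : nzRingType} (b : nat -> A) : cpow b 1 =1 b.
Proof. exact: cauchy_mul1. Qed.

(** Expanding along one factor, [b j] vanishes for [j < n], while [j = n] leaves the constant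
    coefficient of a positive power of [b], which is 0. *)
Lemma cpow_eq0_order {A : nzRingType} (b : nat -> A) n k i : b 0%N = 0 ->
  (forall j, (j < n)%N -> b j = 0) -> (i <= n)%N -> (1 < k)%N -> cpow b k i = 0.
Proof.
case: k => [|[|k]]// b0 bn iln _; apply: big1 => j _.
have [jn|jn] := ltnP j n; first by rewrite bn ?mul0r.
have -> : (i - j = 0)%N by lia.
by rewrite [X in _ * X](cpow_eq0 b k.+1)// mulr0.
Qed.

Lemma fps2_mul_w0 a b m :
  fps2_mul a b m 0%N = cauchy_mul (fun i => a i 0%N) (fun i => b i 0%N) m.
Proof. by apply: eq_bigr => i _; rewrite big_ord1. Qed.

Lemma fps2_mul_z0 a b n : fps2_mul a b 0%N n = cauchy_mul (a 0%N) (b 0%N) n.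
Proof. by rewrite /fps2_mul big_ord1. Qed.

Lemma fps2_exp_w0 a k m : fps2_exp a k m 0%N = cpow (fun i => a i 0%N) k m.
Proof.
elim: k m => [|k IH] m; first by rewrite /fps2_exp/= /fps2_one andbT.
by rewrite /fps2_exp/= fps2_mul_w0; apply: cauchy_mul_ext.
Qed.

Lemma fps2_exp_z0 a k n : fps2_exp a k 0%N n = cpow (a 0%N) k n.
Proof.
elim: k n => [|k IH] n; first by [].
by rewrite /fps2_exp/= fps2_mul_z0; apply: cauchy_mul_ext.
Qed.

(** On [w = 0] the conjugate series of [b] has coefficients [conjc (b 0 i)]: restricting the
    conjugate to one axis uses [b] on the other axis. *)
Lemma fmap_comp_w0 a b m : Defs.fmap_comp a b m 0%N =
  \sum_(p < m.+1) \sum_(q < m.+1) a p q *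
    cauchy_mul (cpow (fun i => b i 0%N) p) (cpow (fun i => conjc (b 0%N i)) q) m.
Proof.
rewrite /Defs.fmap_comp /fps2_subst addn0; apply: eq_bigr => p _; apply: eq_bigr => q _.
rewrite fps2_mul_w0; congr (_ * _); apply: cauchy_mul_ext => i; exact: fps2_exp_w0.
Qed.

Lemma fmap_comp_z0 a b n : Defs.fmap_comp a b 0%N n =
  \sum_(p < n.+1) \sum_(q < n.+1) a p q *
    cauchy_mul (cpow (b 0%N) p) (cpow (fun i => conjc (b i 0%N)) q) n.
Proof.
rewrite /Defs.fmap_comp /fps2_subst add0n; apply: eq_bigr => p _; apply: eq_bigr => q _.
rewrite fps2_mul_z0; congr (_ * _); apply: cauchy_mul_ext => i; exact: fps2_exp_z0.
Qed.

Variables (lam : C) (alpha : nat -> C) (Fhat Psi : fps2 R).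
Hypotheses (lam_conj : conjc lam * lam = 1) (lam_neq1 : forall n, (0 < n)%N -> lam ^+ n != 1).
Hypotheses (F00 : Fhat 0%N 0%N = 0) (F10 : Fhat 1%N 0%N = lam) (F0 : forall n, Fhat 0%N n = 0).
Hypothesis conjug : formal_conjugacy Fhat (normal_form lam alpha) Psi.

(* The first nonzero coefficient, of degree [m], would force [conj lam ^ m = lam]. *)
Lemma conjugacy_z0 m : Psi 0%N m = 0.
Proof.
have [P00 P10 P01 conjE] := conjug.
elim/ltn_ind: m => m IH.
case: m IH => [|[|m]]// IH; set n := m.+2.
have := conjE 0%N n; rewrite !fmap_comp_z0.
(* As [Fhat] vanishes on [z = 0], only [p = 0] contributes; the induction hypothesis then leaves
   [q = n], where the power of the conjugate of [Fhat] has leading coefficient [conjc lam ^+ n]. *)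
have -> : \sum_(p < n.+1) \sum_(q < n.+1) Psi p q * cauchy_mul (cpow (Fhat 0%N) p)
    (cpow (fun i => conjc (Fhat i 0%N)) q) n = Psi 0%N n * (conjc lam) ^+ n.
  rewrite big_ord_recl/= [X in _ + X]big1 ?addr0; last first.
    move=> p _; apply: big1 => q _; rewrite cauchy_0mul ?mulr0// => i _.
    by apply: cpow_zero.
  rewrite big_ord_recr/= big1 ?add0r; last first.
    by move=> q _; rewrite IH ?mul0r.
  by rewrite cauchy_1mul cpow_diag ?F10// F00 conjc0.
(* On the normal form side only the linear term survives: a resonant term has [p >= 2], and such a
   power of [Psi] on [z = 0] has order above [n]. *)
rewrite big_ord_recl/= [X in X + _]big1 ?add0r; last by move=> q _; rewrite mul0r.
rewrite big_ord_recl/= big_ord_recl/= [X in _ + X + _]big1 ?addr0; last first.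
  by move=> q _; rewrite mul0r.
rewrite [X in _ + X]big1 ?addr0; last first.
  move=> p _; apply: big1 => q _; rewrite cauchy_0mul ?mulr0// => i iln.
  by rewrite [cpow _ _ _](cpow_eq0_order _ n)// lift0.
rewrite /normal_form/= mulr1 cauchy_mul1 cpow1 mulrC => /eqP.
rewrite -subr_eq0 -mulrBl mulf_eq0 => /orP[|/eqP//].
rewrite subr_eq0 => /eqP h; have := lam_neq1 n.+1 isT.
by rewrite exprS -{1}h -exprMn lam_conj expr1n eqxx.
Qed.

(** By [F0] and [conjugacy_z0] the conjugates of [Fhat] and [Psi] vanish on [w = 0], so only the
    terms with [q = 0] remain; in the normal form this is [lam * z] alone. *)
Lemma conjugacy_w0 m :
  comp_series (fun k => Psi k 0%N) (fun k => Fhat k 0%N) m = lam * Psi m 0%N.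
Proof.
have [P00 P10 P01 conjE] := conjug.
case: m => [|m].
  by rewrite /comp_series big_ord1 P00 mul0r mulr0.
have := conjE m.+1 0%N; rewrite !fmap_comp_w0.
have conj0 k n : (forall i, k i = 0) -> cpow (fun i => conjc (k i) : C) n.+1 =1 fun=> 0.
  by move=> k0 i; apply: cpow_zero => j; rewrite k0 conjc0.
have first_col (a : fps2 R) (b k : nat -> C) : (forall i, k i = 0) ->
  \sum_(p < m.+2) \sum_(q < m.+2) a p q * cauchy_mul (cpow b p) (cpow (fun i => conjc (k i)) q) m.+1
  = \sum_(p < m.+2) a p 0%N * cpow b p m.+1.
  move=> k0; apply: eq_bigr => p _; rewrite big_ord_recl/= cauchy_mul1 big1 ?addr0// => q _.
  by rewrite cauchy_mul0 ?mulr0// => i; apply: (conj0 k q).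
rewrite !first_col; [|exact: conjugacy_z0|exact: F0].
rewrite /comp_series => ->; rewrite big_ord_recl/= mul0r add0r big_ord_recl/=.
rewrite big1 ?addr0; last by move=> i _; rewrite mul0r.
by rewrite /normal_form/= mulr1 cpow1.
Qed.

End FormalRestriction.

(** * Expansion of [F] in the variables [z, w] *)

Section Expansion.
Context {R : realType}.
Local Notation C := R[i].

(** Weighting by [t ^+ n] respects Cauchy products, hence powers and compositions; this gives the
    homogeneity of [expansion_coef]. *)
Lemma cauchy_mul_scale (t : C) (a b : nat -> C) :
  cauchy_mul (fun n => t ^+ n * a n) (fun n => t ^+ n * b n) =1
  (fun n => t ^+ n * cauchy_mul a b n).
Proof.
move=> n; rewrite /cauchy_mul mulr_sumr; apply: eq_bigr => i _.
rewrite mulrACA -exprD subnKC//; exact: leq_ord.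
Qed.

Lemma cpow_scale (t : C) (b : nat -> C) k :
  cpow (fun n => t ^+ n * b n) k =1 (fun n => t ^+ n * cpow b k n).
Proof.
elim: k => [|k IH] n; first by rewrite /cpow/= /cone; case: n => [|n]; rewrite ?mul1r// !mulr0.
rewrite -cauchy_mul_scale /cpow/=; exact: cauchy_mul_ext.
Qed.

Lemma comp_series_scale (t : C) (a b : nat -> C) :
  comp_series a (fun n => t ^+ n * b n) =1 (fun n => t ^+ n * comp_series a b n).
Proof.
move=> n; rewrite /comp_series mulr_sumr; apply: eq_bigr => k _.
by rewrite cpow_scale mulrCA.
Qed.

Lemma abs_bound_shift (c : nat -> C) M : c 0%N = 0 -> abs_bound (fun n => c n.+1) M ->
  abs_bound c M.
Proof.
move=> c0 cM [|n]; first by have := cM 0%N; rewrite !big_ord0.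
by rewrite big_ord_recl c0 cabs0 add0r.
Qed.

Lemma abs_boundB (a b : nat -> C) Ma Mb : abs_bound a Ma -> abs_bound b Mb ->
  abs_bound (fun n => a n - b n) (Ma + Mb).
Proof.
move=> aM bM n; apply: le_trans (lerD (aM n) (bM n)); rewrite -big_split/=.
by apply: ler_sum => i _; rewrite -[cabs (b i)]cabsN; apply: cabsD.
Qed.

(** Grading by total degree at a fixed point [(z, w)] turns a series in two variables into a
    sequence, to which one-variable products and compositions apply. *)
Definition homog (a : fps2 R) (z w : C) (n : nat) : C :=
  \sum_(p < n.+1) term2 a z w (val p, (n - p)%N).

Lemma homog_scale a t z w n : homog a (t * z) (t * w) n = t ^+ n * homog a z w n.
Proof.
rewrite /homog mulr_sumr; apply: eq_bigr => p _; rewrite /term2/= !exprMn.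
have -> : t ^+ n = t ^+ p * t ^+ (n - p) by rewrite -exprD subnKC// leq_ord.
ring.
Qed.

Lemma homog_w0 a z n : homog a z 0 n = a n 0%N * z ^+ n.
Proof.
rewrite /homog big_ord_recr/= big1 ?add0r => [|p _].
  by rewrite /term2/= subnn mulr1.
by rewrite /term2/= expr0n subn_eq0 leqNgt ltn_ord mulr0.
Qed.

Lemma homog_z0 a w n : homog a 0 w n = a 0%N n * w ^+ n.
Proof.
rewrite /homog big_ord_recl/= big1 ?addr0 => [|p _].
  by rewrite /term2/= subn0 mulr1.
by rewrite /term2/= expr0n mulr0 mul0r.
Qed.

Lemma convergent2_square_bound (a : fps2 R) : convergent2 a ->
  exists r M, 0 < r /\ square_bound (fun i j => term2 a r%:C r%:C (i, j)) M.
Proof.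
case=> -[A B] /= [/near0_exists[d1 d10 hA] /near0_exists[d2 d20 hB]] AB.
(* Halving puts the point [(r, r)] strictly inside both neighborhoods. *)
pose r := Num.min d1 d2 / 2.
have m0 : 0 < Num.min d1 d2 by rewrite lt_min d10.
have r0 : 0 < r by rewrite divr_gt0.
have /andP[r1 r2] : (r < d1) && (r < d2).
  by rewrite -lt_min /r ltr_pdivrMr// ltr_pMr// ltr1n.
have cr : cabs r%:C = r by rewrite cabsR gtr0_norm.
have S : summable [set: nat * nat] (fun k => (complex.Re `|term2 a r%:C r%:C k|)%:E).
  by apply: (AB (r%:C, r%:C)); split=> /=; [apply: hA | apply: hB]; rewrite cr.
set u := (X in summable _ X) in S.
exists r, (fine (\esum_(k in [set: nat * nat]) `|u k|%E)); split => // n.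
rewrite -lee_fin fineK; last by rewrite -summableE.
apply: esum_ge; exists (`I_n `*` `I_n).
  by split => //; apply: finite_setX; apply: finite_II.
have -> : (\sum_(k \in `I_n `*` `I_n) `|u k| = \sum_(i < n) \sum_(j < n) `|u (val i, val j)|)%E.
  rewrite (fsbig_ord _ n (fun i => (\sum_(j < n) `|u (i, val j)|)%E)).
  under [RHS]eq_fsbigr => i _ do rewrite (fsbig_ord _ n (fun j => `|u (i, j)|%E)).
  rewrite (pair_fsbig _ (fun i j => `|u (i, j)|%E)); [|exact: finite_II|exact: finite_II].
  by apply: eq_fsbigr => -[].
rewrite -sumEFin; apply: lee_sum => i _; rewrite -sumEFin; apply: lee_sum => j _.
by rewrite /u /= lee_fin ler_norm.
Qed.

(** [psum2] sums over squares; by [square_triangle] summation by total degree has the same limit. *)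
Lemma homog_series (a : fps2 R) r M z w : 0 < r ->
  square_bound (fun i j => term2 a r%:C r%:C (i, j)) M -> cabs z <= r -> cabs w <= r ->
  abs_bound (homog a z w) M /\ converges (homog a z w) (psum2 a z w).
Proof.
move=> r0 aM zr wr.
have sb : square_bound (fun i j => term2 a z w (i, j)) M.
  move=> n; apply: le_trans (aM n); apply: ler_sum => i _; apply: ler_sum => j _.
  rewrite /term2/= !cabsM !cabsX !cabsR (gtr0_norm r0).
  apply: ler_pM; rewrite ?mulr_ge0 ?exprn_ge0 ?cabs_ge0//.
    by apply: ler_wpM2l; rewrite ?cabs_ge0// lerXn2r// nnegrE ?cabs_ge0// ltW.
  by rewrite lerXn2r// nnegrE ?cabs_ge0// ltW.
have tb := square_bound_triangle _ _ sb; split => //.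
have [l hl] := abs_bound_converges _ _ tb.
suff -> : psum2 a z w = l by [].
apply: lim_of_converges.
apply: (@squeeze0 _ _ (fun n => cabs (\sum_(i < n) \sum_(j < n) term2 a z w (val i, val j) -
     \sum_(m < n) homog a z w m) + cabs (\sum_(m < n) homog a z w m - l))) => [n|n|].
- exact: cabs_ge0.
- by apply: (le_trans _ (cabsD _ _)); rewrite addrA subrK.
- rewrite -[0 in X in _ --> X](addr0 (0:R)); apply: cvgD => //.
  exact: (square_triangle _ _ sb).
Qed.

Section Coefficients.
Variables (f : nat -> R) (g : fps2 R) (lam : C).

Definition radial_coef (k : nat) : C := cone k + (f k)%:C.

(** The product [u = z w] as a graded series: its only term sits in total degree 2. *)
Definition radial_monomial (u : C) (n : nat) : C := if n == 2%N then u else 0.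

(* The homogeneous part of degree [n] of [lam z (1 + f (z w)) exp (2 pi i g (z, w))]. *)
Definition expansion_coef (z w : C) (n : nat) : C :=
  if n is m.+1 then lam * z *
    cauchy_mul (comp_series radial_coef (radial_monomial (z * w)))
      (comp_series exp_coef (fun k => (0 +i* (2 * pi)) * homog g z w k)) m
  else 0.

Lemma expansion_coef_scale t z w n :
  expansion_coef (t * z) (t * w) n = t ^+ n * expansion_coef z w n.
Proof.
case: n => [|m]; rewrite /expansion_coef ?mulr0// exprS.
have radial_scale : comp_series radial_coef (radial_monomial (t * z * (t * w))) =1
    (fun n => t ^+ n * comp_series radial_coef (radial_monomial (z * w)) n).
  move=> n; rewrite -comp_series_scale; congr (comp_series _ _ _); apply/funext => k.
  by rewrite /radial_monomial; case: eqP => [->|_]; [ring | rewrite mulr0].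
have exp_scale : comp_series exp_coef (fun k => (0 +i* (2 * pi)) * homog g (t * z) (t * w) k) =1
    (fun n => t ^+ n * comp_series exp_coef (fun k => (0 +i* (2 * pi)) * homog g z w k) n).
  move=> n; rewrite -comp_series_scale; congr (comp_series _ _ _); apply/funext => k.
  by rewrite homog_scale mulrCA.
by rewrite (cauchy_mul_ext _ _ _ _ radial_scale exp_scale) cauchy_mul_scale; ring.
Qed.

Lemma radial_monomial_bound u : abs_bound (radial_monomial u) (cabs u).
Proof.
case=> [|[|[|n]]]; rewrite ?big_ord0 ?cabs_ge0//.
- by rewrite big_ord1 /radial_monomial/= cabs0 cabs_ge0.
- by rewrite !big_ord_recl big_ord0 /radial_monomial/= cabs0 !add0r cabs_ge0.
- rewrite !big_ord_recl big1 /radial_monomial/= ?cabs0 ?add0r ?addr0// => i _.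
Qed.

Lemma radial_monomial_converges u : converges (radial_monomial u) u.
Proof.
have := converges_finite (radial_monomial u) 3.
rewrite !big_ord_recl big_ord0 /radial_monomial/= addr0 !add0r; apply => n.
by case: n => [|[|[|n]]].
Qed.

(** The radial series is assumed to converge only at [z * w], which serves both [w = conj z], where
    the sum is [F z], and [w = 0], where it is the value of [F^0]. *)
Lemma expansion_series z w l s Mg Mf : g 0%N 0%N = 0 ->
  abs_bound (homog g z w) Mg -> converges (homog g z w) l ->
  abs_bound (fun k => radial_coef k * (cabs (z * w) ^+ k)%:C) Mf ->
  converges (fun k => radial_coef k * (z * w) ^+ k) s ->
  (exists M, abs_bound (expansion_coef z w) M) /\
  converges (expansion_coef z w) (lam * z * (s * e2pii l)).
Proof.
move=> g0 gM gl fM fs.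
pose tpi : C := 0 +i* (2 * pi).
have GM := abs_boundZ tpi _ _ gM.
have Gl := convergesZ tpi _ _ gl.
have G0 : tpi * homog g z w 0 = 0.
  by rewrite /homog big_ord1 /term2/= g0 !mul0r mulr0.
have eb := exp_abs_bound _ (abs_bound_ge0 _ _ GM).
have c1b := comp_abs_bound radial_coef (radial_monomial (z * w)) _ _ (erefl _)
  (radial_monomial_bound _) fM.
have c1c := comp_converges radial_coef (radial_monomial (z * w)) _ _ _ _ (erefl _)
  (radial_monomial_bound _) (radial_monomial_converges _) fM fs.
have c2b := comp_abs_bound exp_coef _ _ _ G0 GM eb.
have c2c := comp_converges exp_coef _ _ _ _ _ G0 GM Gl eb (exp_converges (tpi * l)).
have Hb := cauchy_mul_abs_bound _ _ _ _ c1b c2b.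
have Hc := cauchy_mul_converges _ _ _ _ _ _ c1b c2b c1c c2c.
split.
  by eexists; apply: abs_bound_shift => //; exact: (abs_boundZ (lam * z) _ _ Hb).
by apply/converges_tail; rewrite /expansion_coef subr0; exact: convergesZ.
Qed.

Lemma line_poly_cauchy_mul (a b : C -> C -> nat -> C) :
  (forall n, line_poly (fun z w => a z w n)) -> (forall n, line_poly (fun z w => b z w n)) ->
  forall n, line_poly (fun z w => cauchy_mul (a z w) (b z w) n).
Proof. by move=> ha hb n; apply: line_poly_sum => i; apply: line_polyM. Qed.

Lemma line_poly_comp (a : nat -> C) (b : C -> C -> nat -> C) :
  (forall n, line_poly (fun z w => b z w n)) ->
  forall n, line_poly (fun z w => comp_series a (b z w) n).
Proof.
move=> hb n; apply: line_poly_sum => k; apply: line_polyM; first exact: line_poly_cst.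
suff hpow m : forall j, line_poly (fun z w => cpow (b z w) m j) by [].
elim: m => [|m IH] j; first exact: line_poly_cst.
exact: (line_poly_cauchy_mul b (fun z w => cpow (b z w) m)).
Qed.

Lemma line_poly_homog a n : line_poly (fun z w => homog a z w n).
Proof.
apply: line_poly_sum => p; apply: line_polyM; last exact: (line_polyX _ _ line_poly_snd).
by apply: line_polyM; [exact: line_poly_cst | exact: (line_polyX _ _ line_poly_fst)].
Qed.

Lemma line_poly_expansion n : line_poly (fun z w => expansion_coef z w n).
Proof.
case: n => [|n]; first exact: line_poly_cst.
apply: line_polyM.
  by apply: line_polyM; [exact: line_poly_cst | exact: line_poly_fst].
apply: (line_poly_cauchy_mul
  (fun z w => comp_series radial_coef (radial_monomial (z * w)))
  (fun z w => comp_series exp_coef (fun k => (0 +i* (2 * pi)) * homog g z w k))) => m.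
  apply: line_poly_comp => k; rewrite /radial_monomial.
  case: eqP => _; last exact: line_poly_cst.
  by apply: line_polyM; [exact: line_poly_fst | exact: line_poly_snd].
apply: (line_poly_comp _ (fun z w k => (0 +i* (2 * pi)) * homog g z w k)) => k.
by apply: line_polyM; [exact: line_poly_cst | exact: line_poly_homog].
Qed.

(** [convergent1] gives ordinary convergence; convergence at [d / 2] yields absolute convergence at
    the smaller radius [d / 4]. *)
Lemma radial_bound : convergent1 f ->
  exists rho M, [/\ 0 < rho,
    (forall u : R, `|u| < rho -> converges (fun k => (f k)%:C * u%:C ^+ k) (psum1 f u)%:C) &
    abs_bound (fun k => (f k)%:C * (rho ^+ k)%:C) M].
Proof.
move=> /nbhs_ballP[d /= d0 hd].
have hf (u : R) : `|u| < d -> cvgn (pseries f u).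
  by move=> ud; apply: hd; rewrite /ball/= sub0r normrN.
have d4 : 0 < d / 4 by rewrite divr_gt0.
have c4 : cvgn (pseries (fun i => `|f i|) (d / 4)).
  apply: (@is_cvg_pseries_inside_norm _ _ (d / 2)).
    by apply: hf; rewrite gtr0_norm ?divr_gt0//; lra.
  by rewrite !gtr0_norm ?divr_gt0//; lra.
exists (d / 4), (limn (pseries (fun i => `|f i|) (d / 4))); split => //.
  move=> u ud; apply: (converges_ext (fun k => (f k * u ^+ k)%:C)) => [k|].
    by rewrite rmorphM rmorphXn.
  apply: real_converges; rewrite /psum1; apply: hf; lra.
move=> n.
have -> : \sum_(i < n) cabs ((f i)%:C * ((d / 4) ^+ i)%:C) =
    pseries (fun i => `|f i|) (d / 4) n.
  rewrite /pseries seriesEord/=; apply: eq_bigr => i _.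
  by rewrite cabsM !cabsR [X in _ * X]ger0_norm// exprn_ge0// ltW.
apply: nondecreasing_cvgn_le => //.
by apply: nondecreasing_series => i _ _; rewrite mulr_ge0// exprn_ge0// ltW.
Qed.

End Coefficients.
End Expansion.

(** * Identification of the Taylor coefficients of [F] *)

Section Main.
Context {R : realType}.
Local Notation C := R[i].

Lemma radial_series (f : nat -> R) rho M : 0 < rho ->
  abs_bound (fun k => (f k)%:C * (rho ^+ k)%:C) M ->
  forall u : R, 0 <= u <= rho ->
  abs_bound (fun k => radial_coef f k * (u ^+ k)%:C) (1 + M).
Proof.
move=> rho0 fM u /andP[u0 ur].
have -> : 1 + M = M + 1 by rewrite addrC.
apply: (abs_bound_ext (fun k => (f k)%:C * (u ^+ k)%:C - - cone k)) => [k|].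
  rewrite /radial_coef mulrDl opprK addrC; congr (_ + _).
  by case: k => [|k]; rewrite /cone/= ?mul0r// expr0 mulr1.
apply: abs_boundB.
  apply: abs_bound_le fM => k; rewrite !cabsM; apply: ler_wpM2l; first exact: cabs_ge0.
  by rewrite !cabsR !normrX !ger0_norm ?lerXn2r ?nnegrE// ltW.
by apply: abs_bound_le cone_abs_bound => k; rewrite cabsN.
Qed.

Lemma radial_converges (f : nat -> R) (u : C) (s : C) :
  converges (fun k => (f k)%:C * u ^+ k) s ->
  converges (fun k => radial_coef f k * u ^+ k) (1 + s).
Proof.
move=> fs; have := convergesD _ _ _ _ cone_converges fs.
apply: converges_ext => k; rewrite /radial_coef mulrDl; congr (_ + _).
by case: k => [|k]; rewrite /cone/= ?mul0r// expr0 mulr1.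
Qed.

(** Along [t z] with [0 < t <= 1] and [w] conjugate, both graded series sum to [F], and their
    difference is a power series in [t] with sum 0. So every degree agrees on the plane
    [w = conj z], and [line_poly_eq0] extends this to all [(z, w)]. *)
Lemma expansion_unique (f : nat -> R) (g : fps2 R) (F : C -> C) (Fhat : fps2 R) (lam : C) :
  convergent1 f -> g 0%N 0%N = 0 -> convergent2 g ->
  (\forall z \near (0 : C),
     F z = lam * z * (1 + (psum1 f (complex.Re (`|z| ^+ 2)))%:C) * e2pii (psum2 g z (conjc z))) ->
  has_expansion F Fhat ->
  forall n z w, homog Fhat z w n = expansion_coef f g lam z w n.
Proof.
move=> /radial_bound[rho [Mf [rho0 fc fM]]] g0 /convergent2_square_bound[rg [Mg [rg0 gM]]].
move=> /near0_exists[d1 d10 FE] [/convergent2_square_bound[rF [MF [rF0 FM]]]].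
move=> /near0_exists[d2 d20 FF] n z w; apply/eqP; rewrite -subr_eq0; apply/eqP.
move: z w.
(* The bound 1 gives [cabs y ^+ 2 <= cabs y], which keeps the argument of [f] below [rho]. *)
pose d := Num.min (Num.min (Num.min rho 1) rg) (Num.min (Num.min d1 d2) rF).
have d0 : 0 < d by rewrite !lt_min rho0 ltr01 rg0 d10 d20 rF0.
apply: (line_poly_eq0 (fun z w => homog Fhat z w n - expansion_coef f g lam z w n) d) => //.
  apply: line_polyD; first exact: line_poly_homog.
  apply: (line_poly_ext (fun z w => -1 * expansion_coef f g lam z w n)).
    by move=> z w; rewrite mulN1r.
  by apply: line_polyM; [exact: line_poly_cst | exact: line_poly_expansion].
move=> z; rewrite !lt_min -!andbA => /and4P[zrho z1 zrg /and3P[zd1 zd2 zrF]].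
have key (y : C) : cabs y <= cabs z ->
    (exists M, abs_bound (fun m => homog Fhat y (conjc y) m - expansion_coef f g lam y (conjc y) m) M)
    /\ converges (fun m => homog Fhat y (conjc y) m - expansion_coef f g lam y (conjc y) m) 0.
  move=> yz.
  have yrho := le_lt_trans yz zrho; have y1 := le_lt_trans yz z1.
  have yrg := le_lt_trans yz zrg; have yd1 := le_lt_trans yz zd1.
  have yd2 := le_lt_trans yz zd2; have yrF := le_lt_trans yz zrF.
  have [hb hc] := homog_series Fhat rF MF y (conjc y) rF0 FM (ltW yrF)
    ltac:(by rewrite cabsJ ltW).
  have [gb gc] := homog_series g rg Mg y (conjc y) rg0 gM (ltW yrg)
    ltac:(by rewrite cabsJ ltW).
  have yy : y * conjc y = (cabs y ^+ 2)%:C by rewrite -sqr_normc cabsE rmorphXn.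
  have cy : cabs (y * conjc y) = cabs y ^+ 2 by rewrite cabsM cabsJ expr2.
  have y2 : cabs y ^+ 2 < rho.
    apply: le_lt_trans yrho; rewrite expr2 -[leRHS]mulr1.
    by apply: ler_wpM2l; [exact: cabs_ge0 | exact: ltW].
  have rb := radial_series f rho Mf rho0 fM (cabs y ^+ 2).
  rewrite sqr_ge0 (ltW y2) in rb; have {}rb := rb isT.
  have rc : converges (fun k => radial_coef f k * (y * conjc y) ^+ k)
      (1 + (psum1 f (cabs y ^+ 2))%:C).
    by apply: radial_converges; rewrite yy; apply: fc; rewrite ger0_norm ?sqr_ge0.
  rewrite -cy in rb.
  have [[ME eb] ec] := expansion_series f g lam y (conjc y) _ _ _ _ g0 gb gc rb rc.
  split; first by exists (MF + ME); exact: abs_boundB.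
  have := convergesB _ _ _ _ hc ec.
  suff -> : psum2 Fhat y (conjc y) = lam * y * ((1 + (psum1 f (cabs y ^+ 2))%:C)
     * e2pii (psum2 g y (conjc y))) by rewrite subrr.
  rewrite -FF// FE// mulrA; congr (_ * (1 + (psum1 f _)%:C) * _).
  by rewrite cabsE -rmorphXn.
have [[M kb] _] := key z (lexx _).
apply: (power_series_eq0 _ M kb) => t /andP[t0 t1].
have tz : cabs (t%:C * z) <= cabs z.
  rewrite cabsM cabsR gtr0_norm// -[leRHS]mul1r.
  by apply: ler_wpM2r => //; exact: cabs_ge0.
have [_] := key _ tz; apply: converges_ext => m.
have -> : conjc (t%:C * z) = t%:C * conjc z by rewrite rmorphM; congr (_ * _); exact: conjc_real.
by rewrite homog_scale expansion_coef_scale -mulrBr mulrC.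
Qed.

End Main.

(** * Linearization of [F^0] by the restriction of a convergent [Psi] *)

Theorem theorem24 (R : realType) (omega : R) (f : nat -> R) (g : fps2 R)
    (F : R[i] -> R[i]) (Fhat : fps2 R) (lam : R[i]) :
  irrational omega ->
  lam = e2pii omega%:C ->
  f 0%N = 0 -> convergent1 f ->
  g 0%N 0%N = 0 -> (forall j k, g k j = (g j k)^*) -> convergent2 g ->
  (\forall z \near (0 : R[i]),
     F z = lam * z * (1 + (psum1 f (complex.Re (`|z| ^+ 2)))%:C)
             * e2pii (psum2 g z (z^*))) ->
  local_analytic_diffeo F ->
  has_expansion F Fhat ->
  ~ analytically_linearizable lam (fun z => lam * z * e2pii (psum2 g z 0)) ->
  forall (alpha : nat -> R[i]) (Psi : fps2 R),
    formal_conjugacy Fhat (normal_form lam alpha) Psi ->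
    ~ convergent2 Psi.
Proof.
move=> irr lamE f0 fcv g0 _ gcv FE _ Fexp nonlin alpha Psi conjug Psicv; apply: nonlin.
have coefE := expansion_unique f g F Fhat lam fcv g0 gcv FE Fexp.
(* The identity of homogeneous parts is read at [(0, 1)], where the factor [z] vanishes; for [F10]
   it is read at [(1, 0)] in degree 1. *)
have F0 n : Fhat 0%N n = 0.
  have := coefE n 0 1; rewrite homog_z0 expr1n mulr1 => ->.
  by case: n => [|n]//; rewrite /expansion_coef mulr0 mul0r.
have F10 : Fhat 1%N 0%N = lam.
  have := coefE 1%N 1 0; rewrite homog_w0 expr1n mulr1 => ->.
  rewrite /expansion_coef /cauchy_mul /comp_series !big_ord1 /cpow/= /radial_coef f0.
  by rewrite /cone/= /exp_coef fact0 invr1 addr0 !mulr1.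
have lam_conj : conjc lam * lam = 1 by rewrite lamE e2pii_conj.
have lam_neq1 n : (0 < n)%N -> lam ^+ n != 1 by rewrite lamE; exact: e2pii_pow_neq1.
have compE := conjugacy_w0 lam alpha Fhat Psi lam_conj lam_neq1 (F0 0%N) F10 F0 conjug.
have [P00 P10 _ _] := conjug.
have [rP [MP [rP0 PM]]] := convergent2_square_bound _ Psicv.
have [rg [Mg [rg0 gM]]] := convergent2_square_bound _ gcv.
have [_ [rF [MF [rF0 FM]]]] : True /\ exists r M, 0 < r /\
    square_bound (fun i j => term2 Fhat r%:C r%:C (i, j)) M.
  by split => //; case: Fexp => /convergent2_square_bound.
have w0 (r : R) : 0 < r -> cabs (0 : R[i]) <= r by rewrite cabs0 => /ltW.
pose h z := psum2 Psi z 0.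
have hser z : cabs z <= rP -> converges (fun n => Psi n 0%N * z ^+ n) (h z).
  move=> zr; have [_] := homog_series Psi rP MP z 0 rP0 PM zr (w0 _ rP0).
  by apply: converges_ext => n; rewrite homog_w0.
have hbound : abs_bound (fun n => Psi n 0%N * (rP ^+ n)%:C) MP.
  have [+ _] := homog_series Psi rP MP rP%:C 0 rP0 PM
    ltac:(by rewrite cabsR gtr0_norm) (w0 _ rP0).
  by apply: abs_bound_ext => n; rewrite homog_w0 rmorphXn.
(* At [w = 0] the radial factor is [1 + f 0 = 1], so the restricted coefficients of [Fhat] sum to
   [F^0 z]. *)
have F0val z : cabs z <= rF -> cabs z <= rg ->
    converges (fun n => Fhat n 0%N * z ^+ n) (lam * z * e2pii (psum2 g z 0)).
  move=> zF zg; have [gb gc] := homog_series g rg Mg z 0 rg0 gM zg (w0 _ rg0).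
  have rc0 : converges (fun k => (f k)%:C * (z * 0) ^+ k) 0.
    apply: (converges_ext (fun=> 0)); last first.
      by have := converges_finite (fun=> 0 : R[i]) 0; rewrite big_ord0; apply.
    by move=> [|k]; rewrite mulr0 ?f0 ?mul0r// expr0n mulr0.
  have rb0 : abs_bound (fun k => radial_coef f k * (cabs (z * 0) ^+ k)%:C) 1.
    apply: abs_bound_le cone_abs_bound => k; rewrite mulr0 cabs0 /radial_coef expr0n.
    by case: k => [|k]; rewrite /= ?mulr0 ?cabs0 ?cabs_ge0// f0 addr0 mulr1.
  have [_] := expansion_series f g lam z 0 _ _ _ _ g0 gb gc rb0 (radial_converges f _ _ rc0).
  by rewrite addr0 mul1r; apply: converges_ext => n; rewrite -coefE homog_w0.
(* The absence of a constant term gains the factor [cabs z / rF]: the absolute sum of [F^0] tends to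
   0 with [z], as substitution into [h] requires. *)
have F0bound z : cabs z <= rF ->
    abs_bound (fun n => Fhat n 0%N * z ^+ n) (cabs z / rF * MF).
  move=> zF; have zr0 : 0 <= cabs z / rF by rewrite divr_ge0 ?cabs_ge0// ltW.
  have [+ _] := homog_series Fhat rF MF rF%:C 0 rF0 FM
    ltac:(by rewrite cabsR gtr0_norm) (w0 _ rF0).
  move=> /(abs_boundZ (cabs z / rF)%:C); rewrite cabsR ger0_norm//.
  apply: abs_bound_le => -[|n]; first by rewrite F0 mul0r cabs0 cabs_ge0.
  rewrite homog_w0 !cabsM [leRHS]mulrCA; apply: ler_wpM2l; first exact: cabs_ge0.
  rewrite !cabsX !cabsR (gtr0_norm rF0) (ger0_norm zr0).
  rewrite !exprS mulrA divfK ?gt_eqF//; apply: ler_wpM2l; first exact: cabs_ge0.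
  by rewrite lerXn2r// nnegrE ?cabs_ge0// ltW.
have MF0 : 0 <= MF by have := FM 0%N; rewrite big_ord0.
exists h; split.
- apply: (exists_near0 _ (rP / 8)) => [|z zr]; first by rewrite divr_gt0.
  by have [L _ []] := power_series_derivable _ _ _ h rP0 hbound hser z zr.
- apply: (converges_unique _ _ _ (hser 0 (w0 _ rP0))).
  apply: (converges_ext (fun=> 0)); last first.
    by have := converges_finite (fun=> 0 : R[i]) 0; rewrite big_ord0; apply.
  by move=> [|n]; rewrite ?P00 ?mul0r// expr0n mulr0.
- by rewrite (power_series_derive0 _ _ _ h rP0 hbound hser).
(* The last bound forces the absolute sum [cabs z / rF * MF] of [F^0] below [rP]; [MF + 1] avoids a
   zero denominator. *)
- pose d := Num.min (Num.min rF rg) (Num.min rP (rP * rF / (MF + 1))).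
  apply: (exists_near0 _ d) => [|z].
    by rewrite !lt_min rF0 rg0 rP0 divr_gt0 ?mulr_gt0 ?ltr_wpDl.
  rewrite !lt_min -!andbA => /and4P[/ltW zF /ltW zg /ltW zP zM].
  have Fb := F0bound z zF; have Fc := F0val z zF zg.
  have beta : cabs z / rF * MF <= rP.
    rewrite ltr_pdivlMr ?ltr_wpDl// in zM.
    rewrite mulrAC ler_pdivrMr//; apply: le_trans (ltW zM).
    by apply: ler_wpM2l; rewrite ?cabs_ge0// lerDl.
  have Pb : abs_bound (fun k => Psi k 0%N * ((cabs z / rF * MF) ^+ k)%:C) MP.
    apply: abs_bound_le hbound => k; rewrite !cabsM; apply: ler_wpM2l; first exact: cabs_ge0.
    have b0 : 0 <= cabs z / rF * MF by rewrite !mulr_ge0 ?invr_ge0 ?cabs_ge0// ltW.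
    by rewrite !cabsR !normrX !ger0_norm ?(ltW rP0)// lerXn2r// nnegrE ltW.
  have F0z : Fhat 0%N 0%N * z ^+ 0 = 0 by rewrite F0 mul0r.
  have Pc := hser _ (le_trans (partial_sum_le _ _ _ Fc Fb) beta).
  (* The composed series sums to [h (F^0 z)]; by [compE] its terms are [lam * Psi n 0 * z ^+ n],
     whose sum is [lam * h z]. *)
  apply: (converges_unique _ _ _ (comp_converges _ _ _ _ _ _ F0z Fb Fc Pb Pc)).
  apply: converges_ext (convergesZ lam _ _ (hser z zP)) => n.
  rewrite (_ : (fun n => Fhat n 0%N * z ^+ n) = (fun n => z ^+ n * Fhat n 0%N)).
    by rewrite comp_series_scale compE; ring.
  by apply/funext => k; rewrite mulrC.
Qed.
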